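(* Let $(\mathcal R,\Lambda,S)$ be a generalized Renner-Coxeter system with group of units $W$. Define $\mathcal{GJ}^{+}=\{r\in\mathcal R\mid r=xey$ in left standard form with $x=1\}$, $\mathcal{JG}^{-}=\{r\in\mathcal R\mid r=yex$ in right standard form with $x=1\}$, $\mathcal O=\{r\in\mathcal R\mid r=aebec$ in hybrid standard form with $b=1\}$. Then: (1) $\mathcal{GJ}^{+}=\{r\in\mathcal R\mid\forall s\in L_r,\ r\leq^{+}s\}$, $\mathcal{JG}^{-}=\{r\in\mathcal R\mid\forall s\in R_r,\ r\leq^{-}s\}$, $\mathcal O=\{r\in\mathcal R\mid\forall s\in H_r,\ r\leq^{+}s\}$, and $\mathcal O=\{r\in\mathcal R\mid\forall s\in H_r,\ r\leq^{-}s\}$. (2) $(\mathcal{GJ}^{+})^{*}=\mathcal{JG}^{-}$ and $\mathcal O=\mathcal O^{*}$. (3) $\mathcal{GJ}^{+}$, $\mathcal{JG}^{-}$ and $\mathcal O$ are monoids (submonoids of $\mathcal R$). (4) $\mathcal O$ is the smallest (sub)monoid of $\mathcal R$ containing both $\mathcal{GJ}^{+}$ and $\mathcal{JG}^{-}$; the smallest inverse (sub)monoid containing $\mathcal{GJ}^{+}$; and the smallest inverse (sub)monoid containing $\mathcal{JG}^{-}$. (5) $E(\mathcal R)\subseteq\mathcal O$. (6) If $r\leq^{+}s$, then $a\leq^{+}b$ where $a\in\mathcal{GJ}^{+}\cap L_r$ and $b\in\mathcal{GJ}^{+}\cap L_s$. (7) If $r\leq^{-}s$, then $a\leq^{-}b$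 where $a\in\mathcal{JG}^{-}\cap R_r$ and $b\in\mathcal{JG}^{-}\cap R_s$. (8) The canonical maps $\mathcal{GJ}^{+}\to\mathcal R/\mathscr L$ and $\mathcal{JG}^{-}\to\mathcal R/\mathscr R$ are bijections (every $\mathscr L$-class contains exactly one element of $\mathcal{GJ}^{+}$, every $\mathscr R$-class exactly one element of $\mathcal{JG}^{-}$). (9) The canonical map $\mathcal O\to\mathcal R/\mathscr H$ is a bijection.
   Context: For a Coxeter system $(W,S)$, $\leq$ is the Bruhat order. For $I\subseteq S$, $W_I$ is the subgroup generated by $I$; $W^I$ (resp. ${}^IW$) is the set of $w\in W$ that are the Bruhat-minimum of $wW_I$ (resp. $W_Iw$). A generalized Renner-Coxeter system is a triple $(\mathcal R,\Lambda,S)$ such that: (i) $\mathcal R$ is a factorizable monoid with group of units $W$, i.e. $\mathcal R=E(\mathcal R)W=WE(\mathcal R)$, where the set $E(\mathcal R)$ of idempotents is a meet semilattice under $e\leq f\Leftrightarrow ef=fe=e$ (meet = product; thus $\mathcal R$ is an inverse monoid); (ii) $\Lambda$ is a transversal of $E(\mathcal R)$ for the conjugation action of $W$ and a sub-meet semilattice; (iii) $(W,S)$ is a Coxeter system; (iv) for every $e\leq e'$ in $E(\mathcal R)$ there are $w\in W$ and $f\leq f'$ in $\Lambda$ with $wew^{-1}=f$, $we'w^{-1}=f'$; (v) the map $\lambda^*(e)=\{s\in S\mid se=es\neq e\}$ on $\Lambda$ satisfies $e\leq f\Rightarrow\lambda^*(e)\subseteq\lambda^*(f)$; (vi) for every $e\in\Lambda$,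 $\{w\in W\mid we=ew\}$ and $\{w\in W\mid we=ew=e\}$ are standard parabolic subgroups of $W$. The subsets $\lambda(e),\lambda_*(e)\subseteq S$ are defined by $W_{\lambda(e)}=\{w\in W\mid we=ew\}$ and $W_{\lambda_*(e)}=\{w\in W\mid we=ew=e\}$. Each $r\in\mathcal R$ has unique decompositions: left standard form $r=xey$ ($e\in\Lambda$, $x\in W^{\lambda_*(e)}$, $y\in{}^{\lambda(e)}W$); right standard form $r=yex$ ($e\in\Lambda$, $y\in W^{\lambda(e)}$, $x\in{}^{\lambda_*(e)}W$); hybrid standard form $r=aebec$ ($e\in\Lambda$, $a\in W^{\lambda(e)}$, $b\in W_{\lambda^*(e)}$, $c\in{}^{\lambda(e)}W$). Adherence orders: if $r=xey$, $s=afb$ are in left standard form, $r\leq^{+}s$ iff $e\leq f$ and there is $w\in W_{\lambda^*(f)}W_{\lambda_*(e)}$ with $x\leq aw$ and $w^{-1}b\leq y$. If $r=yex$, $s=bfa$ are in right standard form, $r\leq^{-}s$ iff $e\leq f$ and there is $w\in W_{\lambda_*(e)}W_{\lambda^*(f)}$ with $x\leq wa$ and $bw^{-1}\leq y$. Green's relations: $r\mathscr Ls$ iff $\mathcal Rr=\mathcal Rs$ (iff $Wr=Ws$); $r\mathscr Rs$ iff $r\mathcal R=s\mathcal R$ (iff $rW=sW$); $\mathscr H=\mathscr L\cap\mathscr R$. $L_r,R_r,H_r$ denote the corresponding classes of $r$. $r^{*}$ is the unique inverse of $r$ ($rr^*r=r$, $r^*rr^*=r^*$), and $X^*=\{r^*\mid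 r\in X\}$. *)

(* Defs.v *)
From HB Require Import structures.
From mathcomp Require Import all_boot.
From mathcomp Require Import boolp classical_sets functions.
From Stdlib Require Import Relation_Operators.

Set Implicit Arguments.
Unset Strict Implicit.
Unset Printing Implicit Defensive.

Local Open Scope classical_set_scope.
Local Open Scope group_scope.

Definition are_inverse (R : monoidType) (w v : R) : Prop :=
  w * v = 1 /\ v * w = 1.

Definition invertible (R : monoidType) : pred R :=
  fun w => `[< exists v, are_inverse w v >].

Record unit_group (R : monoidType) : Type :=
  UnitOf { unit_val :> R ; unit_valP : invertible unit_val }.

HB.instance Definition _ (R : monoidType) :=
  [isSub of unit_group R for @unit_val R].
HB.instance Definition _ (R : monoidType) := [Choice of unit_group R by <:].

Lemma invertible_closed (R : monoidType) : monoid_closed (@invertible R).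
Proof.
split=> [|x y]; first by apply/asboolP; exists 1; split; rewrite mulg1.
move=> /asboolP[x' [xx' x'x]] /asboolP[y' [yy' y'y]].
apply/asboolP; exists (y' * x'); split.
- by rewrite mulgA -(mulgA x) yy' mulg1.
- by rewrite mulgA -(mulgA y') x'x mulg1.
Qed.

HB.instance Definition _ (R : monoidType) :=
  SubChoice_isSubMonoid.Build R (@invertible R) (unit_group R)
    (@invertible_closed R).

Lemma unit_inv_ex (R : monoidType) (w : unit_group R) :
  exists v : unit_group R, are_inverse w v.
Proof.
case: w => w wU; have /asboolP[v [wv vw]] := wU.
have vU : invertible v by apply/asboolP; exists w.
by exists (UnitOf vU); split; apply: val_inj; rewrite valM val1.
Qed.

Definition unit_inv (R : monoidType) (w : unit_group R) : unit_group R :=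
  projT1 (cid (unit_inv_ex w)).

HB.instance Definition _ (R : monoidType) :=
  hasInv.Build (unit_group R) (@unit_inv R).

Lemma unit_mulVg (R : monoidType) :
  left_inverse 1 (@unit_inv R) (@mul (unit_group R)).
Proof. by move=> w; case: (projT2 (cid (unit_inv_ex w))). Qed.

Lemma unit_mulgV (R : monoidType) :
  right_inverse 1 (@unit_inv R) (@mul (unit_group R)).
Proof. by move=> w; case: (projT2 (cid (unit_inv_ex w))). Qed.

HB.instance Definition _ (R : monoidType) :=
  Monoid_isGroup.Build (unit_group R) (@unit_mulVg R) (@unit_mulgV R).

Definition is_subgroup (G : groupType) (H : set G) : Prop :=
  H 1 /\ forall x y, H x -> H y -> H (x / y).

Definition gen_subgroup (G : groupType) (I : set G) : set G :=
  smallest (@is_subgroup G) I.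

Definition is_word (G : groupType) (S : set G) (u : seq G) : Prop :=
  forall x, x \in u -> S x.

Definition word_val (G : groupType) (u : seq G) : G := \prod_(x <- u) x.

(* Entries indexed by S; the value 0 stands for infinity, i.e. for the absence
   of a relation. *)
Definition coxeter_matrix (G : groupType) (S : set G) (m : G -> G -> nat) :
    Prop :=
  forall s t, S s -> S t -> m s t = m t s /\ (m s t = 1%N <-> s = t).

(* Words modulo insertion and deletion of the relators (s t)^(m s t). Since
   (s s)^(m s s) = s s is a relator, each letter is its own inverse, so that the
   words in S modulo this relation are the group presented by these relators. *)
Inductive word_step (G : groupType) (S : set G) (m : G -> G -> nat) :
    seq G -> seq G -> Prop :=
| WordStep u v s t : S s -> S t ->
    word_step S m (u ++ flatten (nseq (m s t) [:: s; t]) ++ v) (u ++ v).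

Definition word_equiv (G : groupType) (S : set G) (m : G -> G -> nat) :
    seq G -> seq G -> Prop :=
  clos_refl_sym_trans _ (word_step S m).

(* S may be infinite. *)
Definition coxeter_system (G : groupType) (S : set G) : Prop :=
  gen_subgroup S = setT /\
  exists m, coxeter_matrix S m /\
    forall u v, is_word S u -> is_word S v ->
      (word_val u = word_val v <-> word_equiv S m u v).

(* The default value 0 is never used when (G, S) is a Coxeter system, since
   every element is then the value of a word. *)
Definition coxeter_length (G : groupType) (S : set G) (w : G) : nat :=
  xget 0%N [set n | (exists u, [/\ is_word S u, word_val u = w & size u = n]) /\
                    (forall u, is_word S u -> word_val u = w -> n <= size u)].

Definition reflection (G : groupType) (S : set G) : set G :=
  [set t | exists w s, S s /\ t = w * s * w^-1].

Definition bruhat_step (G : groupType) (S : set G) (u v : G) : Prop :=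
  (exists2 t, reflection S t & v = u * t) /\
  coxeter_length S u < coxeter_length S v.

Definition bruhat (G : groupType) (S : set G) : G -> G -> Prop :=
  clos_refl_trans _ (bruhat_step S).

(* W^I and ^IW: w is the Bruhat minimum of its coset, which it represents. *)
Definition min_left_coset (G : groupType) (S I : set G) : set G :=
  [set w | forall v, gen_subgroup I v -> bruhat S w (w * v)].
Definition min_right_coset (G : groupType) (S I : set G) : set G :=
  [set w | forall v, gen_subgroup I v -> bruhat S w (v * w)].

Definition std_parabolic (G : groupType) (S H : set G) : Prop :=
  exists2 I, I `<=` S & gen_subgroup I = H.

(* The subset of S generating the standard parabolic subgroup H; it is unique
   when (G, S) is a Coxeter system. *)
Definition parabolic_type (G : groupType) (S H : set G) : set G :=
  xget set0 [set I | I `<=` S /\ gen_subgroup I = H].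

Definition idempotents (R : monoidType) : set R := [set e | e * e = e].

Definition idem_le (R : monoidType) (e f : R) : Prop := e * f = e /\ f * e = e.

Definition centralizer (R : monoidType) (e : R) : set (unit_group R) :=
  [set w : unit_group R | (w : R) * e = e * (w : R)].

Definition fixer (R : monoidType) (e : R) : set (unit_group R) :=
  [set w : unit_group R | (w : R) * e = e /\ e * (w : R) = e].

Arguments centralizer {R} e.
Arguments fixer {R} e.

(* lambda(e), lambda_*(e) and lambda^*(e), in this order *)
Definition lam (R : monoidType) (S : set (unit_group R)) (e : R) :=
  parabolic_type S (centralizer e).
Definition lam_sub (R : monoidType) (S : set (unit_group R)) (e : R) :=
  parabolic_type S (fixer e).
Definition lam_sup (R : monoidType) (S : set (unit_group R)) (e : R) :
    set (unit_group R) :=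
  [set s | [/\ S s, (s : R) * e = e * (s : R) & e * (s : R) <> e]].

Record renner_coxeter (R : monoidType) (Lambda : set R)
    (S : set (unit_group R)) : Prop := RennerCoxeter {
  rc_factor_l : forall r : R,
    exists e, exists w : unit_group R, idempotents e /\ r = e * (w : R);
  rc_factor_r : forall r : R,
    exists e, exists w : unit_group R, idempotents e /\ r = (w : R) * e;
  rc_meet : forall e f : R, idempotents e -> idempotents f ->
    [/\ idempotents (e * f), idem_le (e * f) e, idem_le (e * f) f &
        forall g, idempotents g -> idem_le g e -> idem_le g f ->
          idem_le g (e * f)];
  rc_Lambda_idem : Lambda `<=` @idempotents R;
  rc_transversal : forall e : R, idempotents e ->
    exists! f, Lambda f /\
      exists w : unit_group R, (w : R) * e * (w^-1 : R) = f;
  rc_Lambda_meet : forall e f, Lambda e -> Lambda f -> Lambda (e * f);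
  rc_coxeter : coxeter_system S;
  rc_conj_pair : forall e e' : R, idempotents e -> idempotents e' ->
    idem_le e e' ->
    exists w : unit_group R, exists f f', [/\ Lambda f, Lambda f', idem_le f f',
      (w : R) * e * (w^-1 : R) = f & (w : R) * e' * (w^-1 : R) = f'];
  rc_lam_sup_mono : forall e f, Lambda e -> Lambda f -> idem_le e f ->
    lam_sup S e `<=` lam_sup S f;
  rc_centralizer : forall e, Lambda e -> std_parabolic S (centralizer e);
  rc_fixer : forall e, Lambda e -> std_parabolic S (fixer e)
}.

Definition left_std_form (R : monoidType) (Lambda : set R)
    (S : set (unit_group R)) (r : R) (x : unit_group R) (e : R)
    (y : unit_group R) : Prop :=
  [/\ r = (x : R) * e * (y : R), Lambda e, min_left_coset S (lam_sub S e) x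
    & min_right_coset S (lam S e) y].

Definition right_std_form (R : monoidType) (Lambda : set R)
    (S : set (unit_group R)) (r : R) (y : unit_group R) (e : R)
    (x : unit_group R) : Prop :=
  [/\ r = (y : R) * e * (x : R), Lambda e, min_left_coset S (lam S e) y
    & min_right_coset S (lam_sub S e) x].

Definition hybrid_std_form (R : monoidType) (Lambda : set R)
    (S : set (unit_group R)) (r : R) (a : unit_group R) (e : R)
    (b c : unit_group R) : Prop :=
  [/\ r = (a : R) * e * (b : R) * e * (c : R), Lambda e,
      min_left_coset S (lam S e) a,
      gen_subgroup (lam_sup S e) b & min_right_coset S (lam S e) c].

Definition le_plus (R : monoidType) (Lambda : set R) (S : set (unit_group R))
    (r s : R) : Prop :=
  exists x e y a f b,
    [/\ left_std_form Lambda S r x e y, left_std_form Lambda S s a f b,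
        idem_le e f
      & exists w, [/\ [set u * v | u in gen_subgroup (lam_sup S f)
                                 & v in gen_subgroup (lam_sub S e)] w,
                      bruhat S x (a * w) & bruhat S (w^-1 * b) y]].

Definition le_minus (R : monoidType) (Lambda : set R) (S : set (unit_group R))
    (r s : R) : Prop :=
  exists y e x b f a,
    [/\ right_std_form Lambda S r y e x, right_std_form Lambda S s b f a,
        idem_le e f
      & exists w, [/\ [set u * v | u in gen_subgroup (lam_sub S e)
                                 & v in gen_subgroup (lam_sup S f)] w,
                      bruhat S x (w * a) & bruhat S (b * w^-1) y]].

Definition GJ_plus (R : monoidType) (Lambda : set R) (S : set (unit_group R)) :
    set R :=
  [set r | exists e y, left_std_form Lambda S r 1 e y].

Definition JG_minus (R : monoidType) (Lambda : set R) (S : set (unit_group R)) :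
    set R :=
  [set r | exists y e, right_std_form Lambda S r y e 1].

Definition O_mon (R : monoidType) (Lambda : set R) (S : set (unit_group R)) :
    set R :=
  [set r | exists a e c, hybrid_std_form Lambda S r a e 1 c].

Definition greenL (R : monoidType) (r s : R) : Prop :=
  [set x * r | x in [set: R]] = [set x * s | x in [set: R]].
Definition greenR (R : monoidType) (r s : R) : Prop :=
  [set r * x | x in [set: R]] = [set s * x | x in [set: R]].
Definition greenH (R : monoidType) (r s : R) : Prop :=
  greenL r s /\ greenR r s.

Definition classL (R : monoidType) (r : R) : set R := [set s | greenL r s].
Definition classR (R : monoidType) (r : R) : set R := [set s | greenR r s].
Definition classH (R : monoidType) (r : R) : set R := [set s | greenH r s].

Definition weak_inverse (R : monoidType) (r t : R) : Prop :=
  r * t * r = r /\ t * r * t = t.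

(* In an inverse monoid the weak inverse exists and is unique, so the default
   value 1 is never used. *)
Definition star (R : monoidType) (r : R) : R :=
  xget 1 [set t | weak_inverse r t].

Definition is_submonoid (R : monoidType) (M : set R) : Prop :=
  M 1 /\ forall x y, M x -> M y -> M (x * y).

Definition is_inverse_submonoid (R : monoidType) (M : set R) : Prop :=
  is_submonoid M /\ forall r, M r -> exists! t, M t /\ weak_inverse r t.

Definition is_smallest (T : Type) (C : set T -> Prop) (A M : set T) : Prop :=
  [/\ C M, A `<=` M & forall N, C N -> A `<=` N -> M `<=` N].

(* Main.v *)
(* Write N(w, t) for the parity of the number of occurrences of the reflection t
   among the reflections of a word of w. It depends on w only, satisfies the
   cocycle rule N(x y, t) = N(y, t) + N(x, y t y^-1), and N(w, t) = 1 exactly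
   when w t < w. Thus w is minimal in w W_I iff N(w, s) = 0 for all s in I, iff
   N(w, t) = 0 for all reflections t in W_I.

   For e in Lambda, lambda_*(e) and lambda^*(e) commute elementwise and exhaust
   lambda(e). If h is in Lambda and x, y^-1 have no descent in lambda^*(h), then
   x h y is in O, and h y is in GJ+. For e, f in Lambda and w in W, axiom (iv)
   applied to the idempotent e (w f w^-1), below e and below w f w^-1, yields
   w = v g u with v in C(e), u in C(f) and g fixing some h in Lambda below e and
   f, such that e w f = v h u. The cocycle rule transports the absence of
   descents from w to v and u^-1, so GJ+ and O are closed under products.

   The involution r -> r* sends x e y to y^-1 e x^-1, hence exchanges left and
   right standard forms, L and R, the two orders, and GJ+ and JG-, and it
   preserves O; every statement on <=^- follows from one on <=^+. Comparing r
   with an L-equivalent element only involves w in W_lambda(e), and then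
   w^-1 y <= y forces w = 1, which leaves the Bruhat comparison of the left
   factors. *)

Require Import Defs.
From mathcomp Require Import all_boot.
From mathcomp Require Import boolp classical_sets functions.
From Stdlib Require Import Relation_Operators.

Set Implicit Arguments.
Unset Strict Implicit.
Unset Printing Implicit Defensive.

Local Open Scope classical_set_scope.
Local Open Scope group_scope.

(** * Words and the parity of inversions *)

Section Words.
Variable G : groupType.
Implicit Types (x y s t w : G) (u v : seq G) (I S : set G).

Lemma word_val_nil : word_val [::] = 1 :> G.
Proof. exact: big_nil. Qed.

Lemma word_val_cons x u : word_val (x :: u) = x * word_val u.
Proof. exact: big_cons. Qed.

Lemma word_val_cat u v : word_val (u ++ v) = word_val u * word_val v.
Proof. exact: big_cat. Qed.

Lemma word_val1 x : word_val [:: x] = x.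
Proof. by rewrite word_val_cons word_val_nil mulg1. Qed.

Lemma is_word_nil S : is_word S [::].
Proof. by []. Qed.

Lemma is_word_cons S x u : is_word S (x :: u) <-> S x /\ is_word S u.
Proof.
split=> [Sxu|[Sx Su] y]; last by rewrite inE => /predU1P[->|/Su].
by split=> [|y yu]; apply: Sxu; rewrite inE ?eqxx// yu orbT.
Qed.

Lemma is_word_cat S u v : is_word S (u ++ v) <-> is_word S u /\ is_word S v.
Proof.
split=> [Suv|[Su Sv] x]; last by rewrite mem_cat => /orP[/Su|/Sv].
by split=> x xu; apply: Suv; rewrite mem_cat xu ?orbT.
Qed.

Lemma is_word1 S x : S x -> is_word S [:: x].
Proof. by move=> Sx; apply/is_word_cons. Qed.

Lemma is_wordS I S u : I `<=` S -> is_word I u -> is_word S u.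
Proof. by move=> IS Iu x /Iu/IS. Qed.

Lemma is_word_rev S u : is_word S u -> is_word S (rev u).
Proof. by move=> Su x; rewrite mem_rev => /Su. Qed.

Lemma gen_subgroup_sub I : I `<=` gen_subgroup I.
Proof. exact: sub_gen_smallest. Qed.

Lemma gen_is_subgroup I : is_subgroup (gen_subgroup I).
Proof.
split=> [M [[M1 _] _] //|x y Ix Iy M MI].
by case: (MI) => -[_ MV] _; apply: MV; [apply: Ix|apply: Iy].
Qed.

Lemma subgroupV I x : is_subgroup I -> I x -> I x^-1.
Proof. by move=> [I1 IV] Ix; rewrite -[_^-1]mul1g; apply: IV. Qed.

Lemma subgroupM I x y : is_subgroup I -> I x -> I y -> I (x * y).
Proof.
by move=> sI Ix Iy; rewrite -[y]invgK; apply: sI.2 => //; apply: subgroupV.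
Qed.

Lemma gen1 I : gen_subgroup I 1.
Proof. exact: (gen_is_subgroup I).1. Qed.

Lemma genV I x : gen_subgroup I x -> gen_subgroup I x^-1.
Proof. exact: (subgroupV (gen_is_subgroup I)). Qed.

Lemma genM I x y : gen_subgroup I x -> gen_subgroup I y -> gen_subgroup I (x *
  y).
Proof. exact: (subgroupM (gen_is_subgroup I)). Qed.

Lemma genJ I x y : gen_subgroup I x -> gen_subgroup I y -> gen_subgroup I (x ^
  y).
Proof. by move=> Ix Iy; apply: genM; [apply: genV|apply: genM]. Qed.

Lemma gen_subP I H : is_subgroup H -> I `<=` H -> gen_subgroup I `<=` H.
Proof. by move=> sH IH; apply: smallest_sub. Qed.

Lemma gen_word I u : is_word I u -> gen_subgroup I (word_val u).
Proof.
elim: u => [_|x u IHu /is_word_cons[Ix Iu]]; first by rewrite word_val_nil;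
  apply: gen1.
by rewrite word_val_cons; apply: genM; [apply: gen_subgroup_sub|apply: IHu].
Qed.

(* The parity of the number of occurrences of t among the reflections
   (x_k ... x_(i+1))^-1 x_i (x_k ... x_(i+1)) of the word u = x_1 ... x_k. *)
Fixpoint inv_parity u t : bool :=
  if u is x :: v then (t == x ^ word_val v) (+) inv_parity v t else false.

(** This is the cocycle rule at the level of words: appending [v] conjugates every reflection of [u]
    by the value of [v]. *)
Lemma inv_parity_cat u v t :
  inv_parity (u ++ v) t =
  inv_parity v t (+) inv_parity u (t ^ (word_val v)^-1).
Proof.
elim: u => [|x u IHu] /=; first by rewrite addbF.
rewrite IHu word_val_cat conjgM addbCA; congr (_ (+) (_ (+) _)).
by rewrite -(inj_eq (@conjg_inj _ (word_val v)^-1)) conjgK.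
Qed.

Lemma inv_parity_split u t : inv_parity u t ->
  exists u1 x u2, u = u1 ++ x :: u2 /\ t = x ^ word_val u2.
Proof.
elim: u => //= x u IHu; case: eqP => [->|_ /IHu]; first by exists [::], x, u.
by case=> u1 [y [u2 [-> tE]]]; exists (x :: u1), y, u2.
Qed.

(** Read from the right, the reflections of the alternating word are [t], [t s t], [t s t s t] and
    so on, that is, [t * (s * t) ^+ j]. Once [(s * t) ^+ n = 1], the indices [j] and [j + n] give
    the same reflection. *)
Lemma inv_parity_relator s t n r : s * s = 1 -> t * t = 1 ->
  inv_parity (flatten (nseq n [:: s; t])) r =
  \big[addb/false]_(0 <= j < n.*2) (r == t * (s * t) ^+ j).
Proof.
move=> ss tt; have sV : s^-1 = s by apply: mulg1_eq.
have tV : t^-1 = t by apply: mulg1_eq.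
have valE k : word_val (flatten (nseq k [:: s; t])) = (s * t) ^+ k.
  elim: k => [|k IHk]; first by rewrite word_val_nil.
  by rewrite /= !word_val_cons IHk mulgA expgS.
have ta k : t ^ ((s * t) ^+ k) = t * (s * t) ^+ k.*2.
  elim: k => [|k IHk]; first by rewrite conjg1 mulg1.
  rewrite expgSr conjgM IHk doubleS expgSr expgS conjgE invgM sV tV.
  by rewrite !mulgA.
elim: n => [|n IHn]; first by rewrite big_nil.
rewrite doubleS !big_nat_recr //= -IHn !addbA /= word_val_cons valE ta.
rewrite addbC [X in _ (+) X]addbC !addbA; congr (_ (+) _ (+) _).
congr (r == _); rewrite conjgM.
have -> : s ^ t = t * (s * t) by rewrite conjgE tV.
by rewrite conjMg ta /conjg -expgS [in LHS]expgSr mulKg expgSr !mulgA.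
Qed.

End Words.

(** * Inversions, exchange and minimal coset representatives *)

Section Coxeter.
Variables (G : groupType) (S : set G).
Hypothesis cS : coxeter_system S.
Implicit Types (x y s t w : G) (I J : set G).

Let len := coxeter_length S.

Lemma coxeter_sqr s : S s -> s * s = 1.
Proof.
move=> Ss; have [_ [m [mS mP]]] := cS.
have m1 : m s s = 1%N by apply/(mS s s Ss Ss).2.
have Sss : is_word S [:: s; s] by apply/is_word_cons; split=> //;
  apply: is_word1.
have /(mP _ _ Sss (@is_word_nil _ S)) : word_equiv S m [:: s; s] [::].
  by apply: rst_step; have := @WordStep _ S m [::] [::] s s Ss Ss; rewrite m1.
by rewrite !word_val_cons word_val_nil mulg1.
Qed.

Lemma coxeter_inv s : S s -> s^-1 = s.
Proof. by move=> /coxeter_sqr ss; apply: mulg1_eq. Qed.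

Lemma word_val_rev u : is_word S u -> word_val (rev u) = (word_val u)^-1.
Proof.
elim: u => [|x u IHu] Su; first by rewrite word_val_nil invg1.
have [Sx {}Su] := (is_word_cons S x u).1 Su.
rewrite rev_cons -cats1 word_val_cat word_val1 IHu// word_val_cons invgM.
by rewrite (coxeter_inv Sx).
Qed.

Lemma gen_wordP I w : I `<=` S -> gen_subgroup I w ->
  exists2 u, is_word I u & word_val u = w.
Proof.
move=> IS Iw; pose H : set G := [set w | exists2 u,
  is_word I u & word_val u = w].
suff: H w by [].
apply: (@gen_subP _ I H _ _ w Iw) => [|s Is].
  split=> [|x y [u Iu <-] [v Iv <-]]; first by exists [::];
    rewrite ?word_val_nil.
  exists (u ++ rev v); first by apply/is_word_cat; split=> //;
    apply: is_word_rev.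
  by rewrite word_val_cat word_val_rev//; apply: is_wordS Iv.
by exists [:: s]; [apply: is_word1|rewrite word_val1].
Qed.

Lemma gen_min_wordP I w : I `<=` S -> gen_subgroup I w ->
  exists u, [/\ is_word I u, word_val u = w &
    forall v, is_word I v -> word_val v = w -> size u <= size v].
Proof.
move=> IS /(gen_wordP IS)[u Iu uw].
have [n nu] := ubnP (size u); elim: n => // n IHn in u Iu uw nu *.
have [[v [Iv vw vu]]|uP] :=
  pselect (exists v, [/\ is_word I v, word_val v = w & size v < size u]).
  by apply: IHn vw _ => //; apply: leq_trans vu _.
exists u; split=> // v Iv vw; rewrite leqNgt; apply/negP => vu.
by apply: uP; exists v.
Qed.

Lemma genS w : gen_subgroup S w.
Proof. by rewrite cS.1. Qed.

Lemma coxeter_length_wordP w :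
  (exists u, [/\ is_word S u, word_val u = w & size u = len w]) /\
  (forall u, is_word S u -> word_val u = w -> len w <= size u).
Proof.
have [u [Su uw umin]] := gen_min_wordP (@subset_refl _ S) (genS w).
(* The shortest word [u] shows that the defining set is inhabited, so the default 0 is not taken. *)
rewrite /len /coxeter_length; case: xgetP => [n _ //|/(_ (size u))[]].
by split=> //; exists u.
Qed.

Lemma coxeter_length_le u : is_word S u -> len (word_val u) <= size u.
Proof. by move=> Su; apply: (coxeter_length_wordP _).2. Qed.

Lemma coxeter_lengthV w : len w^-1 = len w.
Proof.
have le x : len x^-1 <= len x.
  have [[u [Su <- <-]] _] := coxeter_length_wordP x.
  rewrite -word_val_rev// -(size_rev u); apply: coxeter_length_le.
  exact: is_word_rev.
by apply/eqP; rewrite eqn_leq le/= -{1}[w]invgK le.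
Qed.

(** Here the Coxeter presentation enters: a relator has value 1 and every reflection occurs in it an
    even number of times, so inserting or deleting it changes no parity. *)
Lemma inv_parity_val u v t : is_word S u -> is_word S v ->
  word_val u = word_val v -> inv_parity u t = inv_parity v t.
Proof.
have [_ [m [mS mP]]] := cS => Su Sv /(mP _ _ Su Sv).
suff step a b : word_step S m a b ->
    word_val a = word_val b /\ forall t, inv_parity a t = inv_parity b t.
  move=> uv; suff [] : word_val u = word_val v /\
      forall t, inv_parity u t = inv_parity v t by move=> _ /(_ t).
  elim: uv => {u v Su Sv} [u v /step //|//|u v _ [uv nuv]|u v w _ [uv nuv] _ [vw
    nvw]].
    by split=> // r; rewrite nuv.
  by split=> [|r]; rewrite ?uv// nuv.
case=> {}a {}b x y Sx Sy; set rel := flatten _.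
have Srel : is_word S rel.
  rewrite /rel; elim: (m x y) => [//|k IHk].
  by apply/is_word_cons; split=> //; apply/is_word_cons.
have rel1 : word_val rel = 1.
  rewrite -(word_val_nil G); apply/(mP _ _ Srel (@is_word_nil _ S)).
  by apply: rst_step; have := @WordStep _ S m [::] [::] x y Sx Sy;
    rewrite cats0.
have valE k : word_val (flatten (nseq k [:: x; y])) = (x * y) ^+ k.
  elim: k => [|k IHk]; first by rewrite word_val_nil.
  by rewrite /= !word_val_cons IHk mulgA expgS.
have xy1 : (x * y) ^+ m x y = 1 by rewrite -valE.
have par0 r : inv_parity rel r = false.
  rewrite inv_parity_relator ?coxeter_sqr// -addnn.
  (* The two halves of the index range contribute equal sums, because [(x * y) ^+ m x y = 1], and
     they cancel modulo 2. If [m x y = 0], both are empty. *)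
  rewrite (@big_cat_nat _ _ _ (m x y)) ?leq_addr//=.
  rewrite -{2}[m x y]add0n big_addn addnK.
  under [X in _ (+) X]eq_bigr do rewrite expgnDr xy1 mulg1.
  exact: addbb.
split=> [|r]; first by rewrite !word_val_cat rel1 mul1g.
by rewrite !inv_parity_cat par0 word_val_cat rel1 mul1g addbF.
Qed.

Definition inversion w t : bool :=
  `[< exists u, [/\ is_word S u, word_val u = w & inv_parity u t] >].

Lemma inversion_word u t : is_word S u ->
  inversion (word_val u) t = inv_parity u t.
Proof.
move=> Su; apply/asboolP/idP => [[v [Sv vu]]|ut]; last by exists u.
by rewrite (inv_parity_val t Sv Su vu).
Qed.

Lemma inversionM x y t :
  inversion (x * y) t = inversion y t (+) inversion x (t ^ y^-1).
Proof.
have [u Su <-] := gen_wordP (@subset_refl _ S) (genS x).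
have [v Sv <-] := gen_wordP (@subset_refl _ S) (genS y).
by rewrite -word_val_cat !inversion_word ?inv_parity_cat//; apply/is_word_cat.
Qed.

Lemma inversion1 t : inversion 1 t = false.
Proof. by rewrite -(word_val_nil G) inversion_word. Qed.

Lemma inversion_gen s t : S s -> inversion s t = (t == s).
Proof.
move=> Ss; rewrite -{1}(word_val1 s) inversion_word/=; last exact: is_word1.
by rewrite word_val_nil conjg1 addbF.
Qed.

Lemma inversionV x t : inversion x^-1 t = inversion x (t ^ x).
Proof.
have := inversionM x x^-1 t; rewrite mulgV inversion1 invgK.
by case: inversion; case: inversion.
Qed.

(** * Reflections and strong exchange *)

Lemma reflection_gen s : S s -> reflection S s.
Proof. by move=> Ss; exists 1, s; rewrite invg1 mulg1 mul1g. Qed.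

Lemma reflectionJ t w : reflection S t -> reflection S (t ^ w).
Proof.
move=> [x [s [Ss ->]]]; exists (w^-1 * x), s; split=> //.
by rewrite /conjg invgM invgK !mulgA.
Qed.

Lemma reflection_sqr t : reflection S t -> t * t = 1.
Proof.
move=> [w [s [Ss ->]]].
by rewrite !mulgA mulgVK -(mulgA w) coxeter_sqr// mulg1 mulgV.
Qed.

(** With [t = w * s * w^-1], the contributions of [w] and [w^-1] cancel, and the middle letter
    contributes 1. *)
Lemma inversion_refl t : reflection S t -> inversion t t.
Proof.
move=> [w [s [Ss tE]]]; have sE : t ^ w = s by rewrite tE /conjg !mulgA mulgVK
  mulVg mul1g.
rewrite {1}tE !inversionM invgK inversionV sE (inversion_gen _ Ss).
by rewrite conjgE invgK mulgV mulg1 eqxx; case: inversion.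
Qed.

Lemma inversion_mulr w t : reflection S t -> inversion (w * t) t = ~~ inversion
  w t.
Proof.
move=> rt; rewrite inversionM inversion_refl// conjgE invgK.
by rewrite -(mulg1_eq (reflection_sqr rt)) mulgV mulg1.
Qed.

(* Strong exchange, for words that need not be reduced. *)
Lemma inversion_delete I u t : I `<=` S -> is_word I u ->
  inversion (word_val u) t ->
  gen_subgroup I t /\ exists v, [/\ is_word I v, word_val v = word_val u * t
                                 & (size v).+1 = size u].
Proof.
move=> IS Iu; rewrite inversion_word; last exact: is_wordS Iu.
move=> /inv_parity_split[u1 [s [u2 [uE ->]]]]; move: Iu; rewrite {u}uE.
move=> /is_word_cat[Iu1 /is_word_cons[Is Iu2]]; split.
  by apply: genJ; [apply: gen_subgroup_sub|apply: gen_word].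
exists (u1 ++ u2); split; first exact/is_word_cat.
  by rewrite !word_val_cat word_val_cons /conjg !mulgA mulgK -!mulgA
    (mulgA s) coxeter_sqr ?mul1g//; apply: IS.
by rewrite !size_cat addnS.
Qed.

(** Strong exchange on a reduced word gives one direction. The other follows from it at [w * t],
    since exactly one of [w] and [w * t] has [t] as an inversion. *)
Lemma inversion_length w t : reflection S t ->
  inversion w t = (len (w * t) < len w).
Proof.
move=> rt; have lt x : inversion x t -> len (x * t) < len x.
  have [[u [Su <- <-]] _] := coxeter_length_wordP x.
  move=> /(inversion_delete (@subset_refl _ S) Su)[_ [v [Sv <- <-]]].
  by rewrite ltnS; apply: coxeter_length_le.
apply/idP/idP => [/lt //|]; apply: contraLR => wt.
have := lt (w * t); rewrite inversion_mulr// wt => /(_ isT).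
by rewrite -mulgA reflection_sqr// mulg1 -leqNgt => /ltnW.
Qed.

Lemma gen_inversion I w t : I `<=` S -> gen_subgroup I w -> inversion w t ->
  gen_subgroup I t.
Proof.
by move=> IS /(gen_wordP IS)[u Iu <-] /(inversion_delete IS Iu)[].
Qed.

(** The last letter of a shortest word over [I] works: otherwise strong exchange would delete a
    letter of the remaining prefix and give a shorter word over [I] for [w]. *)
Lemma gen_neq1_inversion I w : I `<=` S -> gen_subgroup I w -> w <> 1 ->
  exists2 s, I s & inversion w s.
Proof.
move=> IS /(gen_min_wordP IS)[u [Iu uw umin]] w1.
case/lastP: u => [|u s] in Iu uw umin *; first by rewrite -uw word_val_nil in
  w1.
move: Iu; rewrite -cats1 => /is_word_cat[Iu /is_word_cons[Is _]];
  exists s => //.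
rewrite -cats1 word_val_cat word_val1 in uw.
have ss : s * s = 1 by apply: coxeter_sqr; apply: IS.
rewrite -uw inversion_mulr; last exact: reflection_gen (IS _ Is).
apply/negP => /(inversion_delete IS Iu)[_ [v [Iv vE vu]]].
by have := umin v Iv; rewrite vE uw => /(_ erefl); rewrite size_rcons -vu ltnNge
  leqnSn.
Qed.

(** Some element of [I] is an inversion of [s], and the only inversion of [s] is [s] itself. *)
Lemma gen_gen I s : I `<=` S -> S s -> gen_subgroup I s -> I s.
Proof.
move=> IS Ss Is; have [s1|s1] := pselect (s = 1).
  by have := inversion_refl (reflection_gen Ss); rewrite s1 inversion1.
have [t It] := gen_neq1_inversion IS Is s1.
by rewrite inversion_gen// => /eqP <-.
Qed.

Lemma gen_inversion_gen I w s : I `<=` S -> S s -> gen_subgroup I w ->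
  inversion w s -> I s.
Proof. by move=> IS Ss Iw /(gen_inversion IS Iw); apply: gen_gen. Qed.

(** * The Bruhat order *)

Lemma bruhat_length x y : bruhat S x y -> x = y \/ len x < len y.
Proof.
elim=> [a b [_ ab]|a|a b c _ [->|ab] _ [<-|bc]]; [by right|by left| | | |].
- by left.
- by right.
- by right.
- by right; apply: ltn_trans ab bc.
Qed.

Lemma bruhat_anti x y : bruhat S x y -> bruhat S y x -> x = y.
Proof.
move=> /bruhat_length[//|xy] /bruhat_length[//|yx].
by have := ltn_trans xy yx; rewrite ltnn.
Qed.

Lemma bruhat_refl x : bruhat S x x.
Proof. exact: rt_refl. Qed.

Lemma bruhat_trans y x z : bruhat S x y -> bruhat S y z -> bruhat S x z.
Proof. exact: rt_trans. Qed.

Lemma bruhatV x y : bruhat S x y -> bruhat S x^-1 y^-1.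
Proof.
elim=> [a b [[t rt bE] ab]|a|a b c _ + _]; [|exact: bruhat_refl|exact:
  bruhat_trans].
apply: rt_step; split; last by rewrite -/len !coxeter_lengthV.
exists (t ^ a^-1); first exact: reflectionJ.
by rewrite bE /conjg invgM invgK !mulgA mulVg mul1g (mulg1_eq (reflection_sqr
  rt)).
Qed.

Lemma bruhat_inversion x s : S s -> inversion x s -> bruhat S (x * s) x.
Proof.
move=> Ss xs; apply: rt_step; split; last by rewrite -inversion_length//;
  apply: reflection_gen.
by exists s; [apply: reflection_gen|rewrite -mulgA coxeter_sqr// mulg1].
Qed.

(** * Minimal coset representatives *)

Lemma no_inversion_in_parabolic I w t : min_left_coset S I w -> reflection S t
  ->
  gen_subgroup I t -> ~~ inversion w t.
Proof.
move=> wmin rt /wmin/bruhat_length wt; rewrite inversion_length// -leqNgt.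
by case: wt => [<-|/ltnW].
Qed.

(** A shortest element [m] of the coset has no inversion in the parabolic subgroup. Hence an
    inversion [s] in [I] of [x] is also one of [m * x], and removing such letters one at a time
    descends from [m * x] to [m] in the Bruhat order. *)
Lemma min_left_coset_ex I w : I `<=` S ->
  exists2 v, gen_subgroup I v & min_left_coset S I (w * v).
Proof.
move=> IS.
have [v [Iv vmin]] : exists v, gen_subgroup I v /\
    forall v', gen_subgroup I v' -> len (w * v) <= len (w * v').
  have [n nw] := ubnP (len w); elim: n => // n IHn in w nw *.
  have [[x [Ix wx]]|wmin] :=
    pselect (exists x, gen_subgroup I x /\ len (w * x) < len w).
    have [v [Iv vmin]] := IHn _ (leq_trans wx nw).
    exists (x * v); split=> [|v' Iv']; first exact: genM.
    rewrite mulgA -[v'](mulVKg x) [in leqRHS]mulgA; apply: vmin.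
    by apply: genM => //; apply: genV.
  exists 1; split=> [|v Iv]; first exact: gen1.
  by rewrite mulg1 leqNgt; apply/negP => wv; apply: wmin; exists v.
exists v => //; set m := w * v in vmin *.
have mmin x : gen_subgroup I x -> len m <= len (m * x).
  by move=> Ix; rewrite -mulgA; apply: vmin; apply: genM.
move=> x; have [n nx] := ubnP (len x); elim: n => // n IHn in x nx *.
move=> Ix; have [->|x1] := pselect (x = 1); first by rewrite mulg1;
  apply: bruhat_refl.
have [s Is xs] := gen_neq1_inversion IS Ix x1; have Ss := IS s Is.
have rs := reflection_gen Ss; have Is' : gen_subgroup I s by apply:
  gen_subgroup_sub.
apply: (@bruhat_trans (m * (x * s))).
  apply: IHn; last exact: genM.
  by rewrite -ltnS; apply: leq_trans nx; rewrite !ltnS -inversion_length.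
rewrite mulgA; apply: bruhat_inversion => //.
rewrite inversionM xs (inversion_length _ (reflectionJ _ rs)) ltnNge mmin//.
by apply: genJ => //; apply: genV.
Qed.

(** A nontrivial [v] has an inversion in [I]; by the cocycle rule it survives in [w * v], as [w]
    contributes 0. *)
Lemma min_left_coset_uniq I w v : I `<=` S -> min_left_coset S I w ->
  gen_subgroup I v -> (forall s, I s -> ~~ inversion (w * v) s) -> v = 1.
Proof.
move=> IS wmin Iv wv; apply: contrapT => /(gen_neq1_inversion IS Iv)[s Is vs].
have rs := reflection_gen (IS s Is); have Is' := gen_subgroup_sub Is.
have := wv s Is; rewrite inversionM vs; apply/negP; rewrite negbK.
apply: (no_inversion_in_parabolic wmin (reflectionJ _ rs)).
by apply: genJ => //; apply: genV.
Qed.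

(** For the converse, [w] is written as the minimal representative of its coset times an element of
    the parabolic subgroup; the absence of inversions forces the latter to be 1. *)
Lemma min_left_cosetP I w : I `<=` S ->
  min_left_coset S I w <-> forall s, I s -> ~~ inversion w s.
Proof.
move=> IS; split=> [wmin s Is|wmin].
  apply: no_inversion_in_parabolic wmin _ _; last exact: gen_subgroup_sub.
  exact/reflection_gen/IS.
have [v Iv vmin] := min_left_coset_ex w IS.
suff v1 : v^-1 = 1 by move: vmin; rewrite -[v]invgK v1 invg1 mulg1.
by apply: (min_left_coset_uniq IS vmin) => [|s /wmin];
  [apply: genV|rewrite mulgK].
Qed.

Lemma min_left_coset_eq I w v : min_left_coset S I w ->
  min_left_coset S I (w * v) -> gen_subgroup I v -> w * v = w.
Proof.
move=> wmin vmin Iv; apply: bruhat_anti (wmin _ Iv).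
by rewrite -{2}[w](mulgK v); apply: vmin; apply: genV.
Qed.

Lemma min_right_cosetV I w : min_right_coset S I w^-1 <-> min_left_coset S I w.
Proof.
split=> wmin v /genV Iv; have /bruhatV := wmin _ Iv.
  by rewrite invgM !invgK.
by rewrite invgM invgK.
Qed.

Lemma min_right_cosetP I w : I `<=` S ->
  min_right_coset S I w <-> forall s, I s -> ~~ inversion w^-1 s.
Proof.
by move=> IS; rewrite -(min_left_cosetP w^-1 IS) -{1}[w]invgK min_right_cosetV.
Qed.

Lemma min_left_coset1 I : I `<=` S -> min_left_coset S I 1.
Proof. by move=> IS; apply/min_left_cosetP => // s _; rewrite inversion1. Qed.

Lemma min_left_coset_sub I J w : I `<=` J ->
  min_left_coset S J w -> min_left_coset S I w.
Proof.
move=> IJ wmin v Iv; apply: wmin; move: v Iv; apply: gen_subP.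
  exact: gen_is_subgroup.
by apply: subset_trans IJ _; apply: gen_subgroup_sub.
Qed.

Lemma bruhat1 w : bruhat S 1 w.
Proof. by rewrite -[w]mul1g; apply: (min_left_coset1 (@subset_refl _ S));
  apply: genS. Qed.

Lemma bruhat_1 w : bruhat S w 1 -> w = 1.
Proof. by move=> w1; apply: bruhat_anti w1 (bruhat1 w). Qed.

(* s t s lies in W_I and s does not, so N(s t s, s) = 0 and N(s t, s) = 1: s is
   one of the reflections t s t and t of the word s t. *)
Lemma gen_commute I s t : I `<=` S -> S s -> ~ I s -> I t ->
  gen_subgroup I (t ^ s) -> commute s t.
Proof.
move=> IS Ss nIs It Its; have St := IS t It; rewrite /conjg coxeter_inv// in
  Its.
have nst : s <> t by move=> st; apply: nIs; rewrite st.
have : ~~ inversion (s * (t * s)) s.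
  by apply/negP => /(gen_inversion_gen IS Ss Its).
rewrite mulgA inversion_mulr; last exact: reflection_gen.
rewrite negbK inversionM inversion_gen//; have /eqP/negPf-> := nst.
rewrite inversion_gen//= conjgE invgK coxeter_inv// => /eqP tst.
by apply: (mulgI t); rewrite tst mulgA coxeter_sqr ?mul1g.
Qed.

End Coxeter.

(** * The inverse monoid *)

Section InverseMonoid.
Variables (R : monoidType) (Lambda : set R) (S : set (unit_group R)).
Hypothesis RC : renner_coxeter Lambda S.
Local Notation W := (unit_group R).
Implicit Types (r s t e f h : R) (w x y z a b c g u v : W).

Lemma unit_valM x y : unit_val (x * y) = (x : R) * (y : R).
Proof. exact: (valM x y). Qed.

Lemma unit_val_1 : unit_val (1 : W) = 1.
Proof. exact: (@val1 R _ W). Qed.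

Lemma unit_valV x : (x : R) * (x^-1 : R) = 1.
Proof. by rewrite -unit_valM mulgV unit_val_1. Qed.

Lemma unit_Vval x : (x^-1 : R) * (x : R) = 1.
Proof. by rewrite -unit_valM mulVg unit_val_1. Qed.

Lemma unit_valK r x : r * (x : R) * (x^-1 : R) = r.
Proof. by rewrite -mulgA unit_valV mulg1. Qed.

Lemma unit_valVK r x : r * (x^-1 : R) * (x : R) = r.
Proof. by rewrite -mulgA unit_Vval mulg1. Qed.

Definition unit_simp := (unit_valV, unit_Vval, unit_valK, unit_valVK, @mul1g R,
  @mulg1 R).

Lemma centralizer_subgroup e : is_subgroup (centralizer e).
Proof.
split=> [|x y xe ye]; first by rewrite /centralizer/= mul1g mulg1.
have yVe : (y^-1 : R) * e = e * (y^-1 : R).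
  by rewrite -[LHS](unit_valK _ y) -(mulgA _ e) -ye mulgA !unit_simp.
by rewrite /centralizer/= -mulgA yVe mulgA xe mulgA.
Qed.

(** Both [e * f] and [f * e] lie below [e], so each of them equals [e * f * e]. *)
Lemma idem_mulC e f : idempotents e -> idempotents f -> e * f = f * e.
Proof.
move=> ee ff; have [_ [_ efe] [_ _] _] := rc_meet RC ee ff.
have [_ _ [_ efe'] _] := rc_meet RC ff ee.
have [_ [efe1 _] _ _] := rc_meet RC ee ff.
by rewrite -[RHS]efe' mulgA efe1.
Qed.

Lemma idempotent_conj e w : idempotents e -> idempotents ((w : R) * e * (w^-1 :
  R)).
Proof.
by move=> ee; rewrite /idempotents/= !mulgA !unit_simp -(mulgA _ e e) ee.
Qed.

Lemma idempotent_conjV e w : idempotents e -> idempotents ((w^-1 : R) * e * (w :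
  R)).
Proof. by move=> /(idempotent_conj w^-1); rewrite invgK. Qed.

(** The idempotent [w * e * w^-1], which is [e * w^-1], commutes with [e]; hence
    [e * w^-1 = e * w^-1 * e = e]. *)
Lemma fixer_left e w : idempotents e -> (w : R) * e = e -> fixer e w.
Proof.
move=> ee we; split=> //; have wVe : (w^-1 : R) * e = e.
  by rewrite -{1}we mulgA !unit_simp.
have := idem_mulC ee (idempotent_conj w ee).
rewrite we mulgA ee -mulgA wVe ee => eV.
by rewrite -{1}eV !unit_simp.
Qed.

Lemma fixer_subgroup e : is_subgroup (fixer e).
Proof.
split=> [|x y [xe ex] [ye ey]]; first by rewrite /fixer/= mul1g mulg1.
split; rewrite unit_valM.
  by rewrite -{1}ye mulgA !unit_simp xe.
by rewrite mulgA ex -{1}ey !unit_simp.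
Qed.

Lemma fixer_centralizer e : fixer e `<=` centralizer e.
Proof. by move=> w [we ew]; rewrite /centralizer/= we ew. Qed.

Lemma fixerJ e w x : fixer e w -> centralizer e x -> fixer e (w ^ x).
Proof.
move=> [we ew] xe; have xVe := subgroupV (centralizer_subgroup e) xe.
rewrite /centralizer/= in xe xVe.
split; rewrite /conjg !unit_valM.
  by rewrite -!mulgA xe (mulgA _ e) we mulgA xVe -mulgA !unit_simp.
by rewrite !mulgA -xVe -(mulgA _ e) ew xVe !unit_simp.
Qed.

(** * Weak inverses and the involution [star] *)

Lemma weak_inverse_uniq r t t' :
  (forall e f, idempotents e -> idempotents f -> e * f = f * e) ->
  weak_inverse r t -> weak_inverse r t' -> t = t'.
Proof.
move=> idC [rtr trt] [rt'r t'rt'].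
have i1 : idempotents (r * t) by rewrite /idempotents/= mulgA rtr.
have i2 : idempotents (r * t') by rewrite /idempotents/= mulgA rt'r.
have i3 : idempotents (t * r) by rewrite /idempotents/= mulgA trt.
have i4 : idempotents (t' * r) by rewrite /idempotents/= mulgA t'rt'.
transitivity (t * r * t').
  rewrite -[LHS]trt -[in LHS]rt'r -!mulgA (mulgA r t') (idC _ _ i2 i1).
  by rewrite !mulgA trt.
rewrite -[RHS]t'rt' -[in RHS]rtr !mulgA -(mulgA _ t r) (idC _ _ i4 i3).
by rewrite -!mulgA (mulgA t' r) t'rt'.
Qed.

Lemma weak_inverse_form x e y : idempotents e ->
  weak_inverse ((x : R) * e * (y : R)) ((y^-1 : R) * e * (x^-1 : R)).
Proof.
by move=> ee; split; rewrite !mulgA !unit_simp -!(mulgA _ e e) !ee -!(mulgA _ e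
  e) ee.
Qed.

Lemma Lambda_conj e : idempotents e ->
  exists f w, Lambda f /\ e = (w^-1 : R) * f * (w : R).
Proof.
move=> /(rc_transversal RC)[f [[Lf [w fE]] _]]; exists f, w.
by split=> //; rewrite -fE !mulgA !unit_simp.
Qed.

Lemma Lambda_form r : exists x e y, Lambda e /\ r = (x : R) * e * (y : R).
Proof.
have [e [w [/Lambda_conj[f [v [Lf ->]]] ->]]] := rc_factor_l RC r.
by exists v^-1, f, (v * w); rewrite unit_valM !mulgA.
Qed.

Lemma star_form x e y : idempotents e ->
  star ((x : R) * e * (y : R)) = (y^-1 : R) * e * (x^-1 : R).
Proof.
move=> ee; apply: xget_unique => [|t]; first exact: weak_inverse_form.
by move=> /weak_inverse_uniq; apply; [exact: idem_mulC|exact: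
  weak_inverse_form].
Qed.

Lemma star_mulr e y : idempotents e -> star (e * (y : R)) = (y^-1 : R) * e.
Proof.
by move=> ee; rewrite -[e in LHS]mul1g -unit_val_1 (star_form 1 y ee) invg1
  unit_val_1 mulg1.
Qed.

Lemma starP r : weak_inverse r (star r).
Proof.
have [x [e [y [/(rc_Lambda_idem RC) ee ->]]]] := Lambda_form r.
by rewrite star_form//; apply: weak_inverse_form.
Qed.

Lemma star_eq r t : weak_inverse r t -> star r = t.
Proof. exact: weak_inverse_uniq idem_mulC (starP r). Qed.

Lemma starK : involutive (@star R).
Proof. by move=> r; apply: star_eq; have [? ?] := starP r. Qed.

Lemma idem_star_l r : idempotents (star r * r).
Proof. by rewrite /idempotents/= mulgA (starP r).2. Qed.

Lemma idem_star_r r : idempotents (r * star r).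
Proof. by rewrite /idempotents/= mulgA (starP r).1. Qed.

Lemma starM r s : star (r * s) = star s * star r.
Proof.
have C := idem_mulC (idem_star_r s) (idem_star_l r).
apply: star_eq; split.
  transitivity (r * (s * star s * (star r * r)) * s); first by rewrite !mulgA.
  by rewrite C !mulgA (starP r).1 -!mulgA (mulgA s) (starP s).1.
transitivity (star s * (star r * r * (s * star s)) * star r);
  first by rewrite !mulgA.
by rewrite -C !mulgA (starP s).2 -!mulgA (mulgA (star r)) (starP r).2.
Qed.

(** * Green's relations through idempotents *)

Lemma greenL_star r s : greenL r s <-> star r * r = star s * s.
Proof.
(* If [r] and [s] are left multiples of each other, each of the commuting idempotents [star r * r]
   and [star s * s] absorbs the other. *)
have mul_star p q : r = p * s -> s = q * r -> star r * r = star s * s.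
  move=> rE sE; transitivity (star r * r * (star s * s)).
    by rewrite [in RHS]rE -!mulgA (mulgA s) (starP s).1 -rE.
  rewrite (idem_mulC (idem_star_l r) (idem_star_l s)).
  by rewrite [in LHS]sE -!mulgA (mulgA r) (starP r).1 -sE.
split=> [rs|rs].
  have /[!rs][[p _ /esym rE]] : [set x * r | x in [set: R]] r by exists 1;
    rewrite ?mul1g.
  have /[!(esym rs)][[q _ /esym sE]] : [set x * s | x in [set: R]] s
    by exists 1; rewrite ?mul1g.
  exact: mul_star rE sE.
apply/seteqP; split=> _ [p _ <-].
  by exists (p * r * star s) => //; rewrite -!mulgA -rs (mulgA r) (starP r).1.
by exists (p * s * star r) => //; rewrite -!mulgA rs (mulgA s) (starP s).1.
Qed.

Lemma greenR_star r s : greenR r s <-> greenL (star r) (star s).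
Proof.
have star_img p : [set x * star p | x in [set: R]] = @star R @` [set p * x | x
  in [set: R]].
  apply/seteqP; split=> [_ [q _ <-]|_ [_ [q _ <-] <-]].
    exists (p * star q); first by exists (star q).
    by rewrite starM starK.
  by rewrite starM; exists (star q).
rewrite /greenL !star_img; split=> [->//|rs].
apply/seteqP; split=> t.
  move=> /(imageP (@star R)); rewrite rs => -[t' + tt'].
  by rewrite -(starK t) -tt' starK.
move=> /(imageP (@star R)); rewrite -rs => -[t' + tt'].
by rewrite -(starK t) -tt' starK.
Qed.

Lemma star_mul_form x e y : idempotents e ->
  star ((x : R) * e * (y : R)) * ((x : R) * e * (y : R)) = (y^-1 : R) * e * (y :
    R).
Proof. by move=> ee; rewrite star_form// !mulgA !unit_simp -(mulgA _ e e) ee.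
  Qed.

Lemma greenL_form x e y x' f y' : idempotents e -> idempotents f ->
  greenL ((x : R) * e * (y : R)) ((x' : R) * f * (y' : R)) <->
  (y^-1 : R) * e * (y : R) = (y'^-1 : R) * f * (y' : R).
Proof. by move=> ee ff; rewrite greenL_star !star_mul_form. Qed.

Lemma greenR_form x e y x' f y' : idempotents e -> idempotents f ->
  greenR ((x : R) * e * (y : R)) ((x' : R) * f * (y' : R)) <->
  (x : R) * e * (x^-1 : R) = (x' : R) * f * (x'^-1 : R).
Proof.
move=> ee ff; rewrite greenR_star !star_form// (greenL_form y^-1 x^-1 y'^-1
  x'^-1 ee ff).
by rewrite !invgK.
Qed.

(** Conjugate elements of a transversal coincide, and the unit conjugating [e] to itself then
    commutes with [e]. *)
Lemma Lambda_conj_eq e f y z : Lambda e -> Lambda f ->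
  (y^-1 : R) * e * (y : R) = (z^-1 : R) * f * (z : R) ->
  e = f /\ centralizer e (z * y^-1).
Proof.
move=> Le Lf ey; have ff : f = ((z * y^-1 : W) : R) * e * ((z * y^-1)^-1 : R).
  by rewrite invgM invgK !unit_valM !mulgA -2!(mulgA (z : R)) ey !mulgA
    !unit_simp.
have [e' [_ uniq]] := rc_transversal RC (rc_Lambda_idem RC Le).
have ef : e = f.
  transitivity e'; [apply/esym|]; apply: uniq; split=> //.
    by exists 1; rewrite invg1 unit_val_1 mulg1 mul1g.
  by exists (z * y^-1); rewrite -ff.
by split=> //; rewrite /centralizer/= [in RHS]ef [in RHS]ff !unit_simp.
Qed.

End InverseMonoid.

(** * Standard forms *)

Section RennerCoxeter.
Variables (R : monoidType) (Lambda : set R) (S : set (unit_group R)).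
Hypothesis RC : renner_coxeter Lambda S.
Local Notation W := (unit_group R).
Implicit Types (r s t e f h : R) (w x y z a b c g u v : W).

Let cS : coxeter_system S := rc_coxeter RC.
Let idemL := rc_Lambda_idem RC.

Local Notation lform := (left_std_form Lambda S).
Local Notation rform := (right_std_form Lambda S).

(** * The parabolic subgroups attached to an element of [Lambda] *)

Lemma lam_spec e : Lambda e -> lam S e `<=` S /\ gen_subgroup (lam S e) =
  centralizer e.
Proof.
move=> /(rc_centralizer RC)[I IS Ie].
(* Axiom (vi) provides [I], so the default [set0] of [parabolic_type] is not taken. *)
by have := @xgetI _ set0 [set I | I `<=` S /\ gen_subgroup I = centralizer e] I
  (conj IS Ie).
Qed.

Lemma lam_sub_spec e : Lambda e ->
  lam_sub S e `<=` S /\ gen_subgroup (lam_sub S e) = fixer e.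
Proof.
move=> /(rc_fixer RC)[I IS Ie].
by have := @xgetI _ set0 [set I | I `<=` S /\ gen_subgroup I = fixer e] I (conj
  IS Ie).
Qed.

Lemma lamS e : Lambda e -> lam S e `<=` S.
Proof. by case/lam_spec. Qed.

Lemma lam_subS e : Lambda e -> lam_sub S e `<=` S.
Proof. by case/lam_sub_spec. Qed.

Lemma lam_supS e : lam_sup S e `<=` S.
Proof. by move=> w []. Qed.

Lemma lam_gen e : Lambda e -> gen_subgroup (lam S e) = centralizer e.
Proof. by case/lam_spec. Qed.

Lemma lam_sub_gen e : Lambda e -> gen_subgroup (lam_sub S e) = fixer e.
Proof. by case/lam_sub_spec. Qed.

Lemma lamP e w : Lambda e -> lam S e w <-> S w /\ centralizer e w.
Proof.
move=> Le; split=> [ew|[Sw ew]].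
  by split; [apply: lamS ew|rewrite -lam_gen//; apply: gen_subgroup_sub].
by apply: (gen_gen cS (lamS Le)) => //; rewrite lam_gen.
Qed.

Lemma lam_subP e w : Lambda e -> lam_sub S e w <-> S w /\ fixer e w.
Proof.
move=> Le; split=> [ew|[Sw ew]].
  by split; [apply: lam_subS ew|rewrite -lam_sub_gen//;
    apply: gen_subgroup_sub].
by apply: (gen_gen cS (lam_subS Le)) => //; rewrite lam_sub_gen.
Qed.

Lemma lam_sub_lam e : Lambda e -> lam_sub S e `<=` lam S e.
Proof.
by move=> Le w /lam_subP[]// Sw /fixer_centralizer we; apply/lamP.
Qed.

Lemma lam_supP e w : lam_sup S e w <-> [/\ S w, centralizer e w & ~ fixer e w].
Proof.
split=> [[Sw we ew]|[Sw we ew]]; split=> //; first by case.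
by move=> eq; apply: ew; split=> //; rewrite we.
Qed.

Lemma lam_split e w : Lambda e -> lam S e w -> lam_sub S e w \/ lam_sup S e w.
Proof.
move=> Le /lamP[]// Sw we; have [ew|ew] := pselect (fixer e w).
  by left; apply/lam_subP.
by right; apply/lam_supP.
Qed.

Lemma lam_sup_nsub e w : Lambda e -> lam_sup S e w -> ~ lam_sub S e w.
Proof. by move=> Le /lam_supP[_ _ ew] /lam_subP[]. Qed.

Lemma lam_sup_gen e : gen_subgroup (lam_sup S e) `<=` centralizer e.
Proof.
by apply: gen_subP; [apply: centralizer_subgroup|move=> w /lam_supP[]].
Qed.

Lemma commute_subgroup w : is_subgroup (commute w).
Proof. by split=> [|x y wx wy]; [apply: commute1|apply: commuteM => //;
  apply: commuteV]. Qed.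

(** It is enough to treat generators [s] and [t]. The fixer is normal in the centralizer, so [t ^ s]
    stays in the subgroup generated by [lam_sub S e], which does not contain [s], and [gen_commute]
    applies. *)
Lemma lam_sup_commute e x y : Lambda e -> gen_subgroup (lam_sup S e) x ->
  fixer e y -> commute x y.
Proof.
move=> Le ex; rewrite -lam_sub_gen//; apply: gen_subP;
  first exact: commute_subgroup.
move=> t et; apply: commute_sym; move: x ex; apply: gen_subP.
  exact: commute_subgroup.
move=> s es; have [Ss se _] := (lam_supP e s).1 es; apply: commute_sym.
apply: (gen_commute cS (lam_subS Le)) => //; first exact: lam_sup_nsub.
rewrite lam_sub_gen//; apply: fixerJ => //.
by have [] := (lam_subP t Le).1 et.
Qed.

(** Since the two factors commute, their products form a subgroup; it contains all generators in
    [lam S e]. *)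
Lemma centralizer_split e w : Lambda e -> centralizer e w ->
  exists x y, [/\ gen_subgroup (lam_sup S e) x, fixer e y & w = x * y].
Proof.
move=> Le; rewrite -lam_gen//.
pose H : set W := [set w | exists x y,
  [/\ gen_subgroup (lam_sup S e) x, fixer e y & w = x * y]].
suff : gen_subgroup (lam S e) `<=` H by move=> /[apply].
apply: gen_subP => [|x /(lam_split Le)[ex|ex]].
- split=> [|_ _ [x [y [ex ey ->]]] [x' [y' [ex' ey' ->]]]].
    by exists 1, 1; split; [apply: gen1|apply: (fixer_subgroup e).1|rewrite
      mulg1].
  have eyy := (fixer_subgroup e).2 _ _ ey ey'.
  exists (x / x'), (y / y'); split=> //; first by apply: (gen_is_subgroup _).2.
  rewrite invgM -!mulgA; congr (x * _); rewrite [LHS]mulgA.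
  by apply: esym; apply: (lam_sup_commute Le _ eyy); apply: genV.
- exists 1, x; split; [exact: gen1| |by rewrite mul1g].
  by have [] := (lam_subP x Le).1 ex.
- exists x, 1; split; [exact: gen_subgroup_sub| |by rewrite mulg1].
  exact: (fixer_subgroup e).1.
Qed.

(** * Left standard forms and the order [le_plus] *)

Lemma lform_ex r : exists x e y, lform r x e y.
Proof.
have [x [e [y [Le ->]]]] := Lambda_form RC r.
(* First [y] is made minimal; the correction [c] commutes with [e] and passes to the left factor. *)
have [c ec /(min_right_cosetV cS) ymin] := min_left_coset_ex cS y^-1 (lamS Le).
rewrite lam_gen// in ec.
(* The left factor is then made minimal by some [v] that [e] absorbs, which leaves the right factor
   unchanged. *)
have [v ev xmin] := min_left_coset_ex cS (x * c) (lam_subS Le).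
rewrite lam_sub_gen// in ev.
exists (x * c * v), e, (y^-1 * c)^-1; split=> //.
have cVe := subgroupV (centralizer_subgroup e) ec.
rewrite invgM invgK !unit_valM -!mulgA (mulgA (v : R) e) ev.1 (mulgA e) -cVe.
by rewrite !mulgA !unit_simp.
Qed.

Lemma min_right_lam_eq e y z : Lambda e -> min_right_coset S (lam S e) y ->
  min_right_coset S (lam S e) z -> centralizer e (z * y^-1) -> y = z.
Proof.
move=> Le; rewrite -{1}[y]invgK -{1}[z]invgK !(min_right_cosetV cS) => ymin zmin
  ezy.
apply: invg_inj; rewrite -[LHS](mulKg z).
by apply: (min_left_coset_eq zmin); rewrite ?mulKg ?lam_gen.
Qed.

(** The L-class is determined by the idempotent [y^-1 * e * y], which in turn determines [e] and the
    coset of [y], hence the minimal element of that coset. *)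
Lemma lform_greenL r s x e y x' f y' : lform r x e y -> lform s x' f y' ->
  greenL r s -> e = f /\ y = y'.
Proof.
move=> [-> Le _ ymin] [-> Lf _ ymin'] /(greenL_form RC)-/(_ (idemL Le) (idemL
  Lf)).
move=> /(Lambda_conj_eq RC Le Lf)[ef eyy]; rewrite -ef in ymin'; split=> //.
exact: min_right_lam_eq ymin ymin' eyy.
Qed.

Lemma lform_uniq r x e y x' f y' : lform r x e y -> lform r x' f y' ->
  [/\ x = x', e = f & y = y'].
Proof.
move=> rf rf'; have [ef yy] := lform_greenL rf rf' erefl; split=> //.
move: rf rf'; rewrite -ef -yy => -[-> Le xmin _] [xx _ xmin' _].
have {}xx : (x : R) * e = (x' : R) * e.
  by rewrite -[LHS](unit_valK _ y) xx unit_valK.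
have ex : fixer e (x'^-1 * x).
  by apply: (fixer_left RC (idemL Le)); rewrite unit_valM -mulgA xx mulgA
    !unit_simp.
rewrite -(mulVKg x' x); apply: (min_left_coset_eq xmin');
  first by rewrite mulVKg.
by rewrite lam_sub_gen.
Qed.

Lemma greenL_lform r s x e y : lform r x e y -> greenL r s ->
  exists x', lform s x' e y.
Proof.
move=> rf rs; have [x' [f [y' sf]]] := lform_ex s.
by have [-> ->] := lform_greenL rf sf rs; exists x'.
Qed.

(** Uniqueness of standard forms lets the existential forms in [le_plus] be replaced by any given
    ones. *)
Lemma lform_le r s x e y a f b : lform r x e y -> lform s a f b ->
  le_plus Lambda S r s ->
  idem_le e f /\
  exists w, [/\ [set u * v | u in gen_subgroup (lam_sup S f)
                           & v in gen_subgroup (lam_sub S e)] w,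
                bruhat S x (a * w) & bruhat S (w^-1 * b) y].
Proof.
move=> rf sf [x' [e' [y' [a' [f' [b' [rf' sf' ef wP]]]]]]].
by have [-> -> ->] := lform_uniq rf rf'; have [-> -> ->] := lform_uniq sf sf'.
Qed.

Lemma lform_le1 r s x e y a f b : lform r x e y -> lform s a f b ->
  idem_le e f -> bruhat S x a -> bruhat S b y -> le_plus Lambda S r s.
Proof.
move=> rf sf ef xa yb; exists x, e, y, a, f, b; split=> //.
exists 1; split; rewrite ?mulg1 ?invg1 ?mul1g//.
by exists 1; [apply: gen1|exists 1; [apply: gen1|rewrite mulg1]].
Qed.

Lemma idem_lexx e : idempotents e -> idem_le e e.
Proof. by []. Qed.

Lemma lform_le_same r s x a e y : lform r x e y -> lform s a e y ->
  le_plus Lambda S r s -> bruhat S x a.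
Proof.
move=> rf sf /(lform_le rf sf)[_ [_ [[u eu [v ev <-]]]]].
have [_ Le _ ymin] := rf.
have euv : gen_subgroup (lam S e) (u * v).
  rewrite lam_gen//; apply: subgroupM; first exact: centralizer_subgroup.
    exact: lam_sup_gen.
  by apply: fixer_centralizer; rewrite -lam_sub_gen.
(* Minimality of [y] gives the reverse comparison with [(u * v)^-1 * y]; antisymmetry then yields
   [u * v = 1]. *)
move=> xauv /bruhat_anti-/(_ (ymin _ (genV euv))) /(canRL (mulgK _)).
by rewrite mulgV => /(canRL (@invgK _)); rewrite invg1 => uv1;
  rewrite uv1 mulg1 in xauv.
Qed.

(** * The involution on standard forms and on the two orders *)

Lemma rform_star r x e y : rform r y e x <-> lform (star r) x^-1 e y^-1.
Proof.
split=> [[rE Le ymin xmin]|[rE Le xmin ymin]]; split=> //.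
- by rewrite rE (star_form RC) //; apply: idemL.
- by apply/(min_right_cosetV cS); rewrite invgK.
- exact/(min_right_cosetV cS).
- by rewrite -(starK RC r) rE (star_form RC) ?invgK //; apply: idemL.
- exact/(min_right_cosetV cS).
- by rewrite -[x]invgK; apply/(min_right_cosetV cS).
Qed.

Lemma JG_star r : JG_minus Lambda S r <-> GJ_plus Lambda S (star r).
Proof.
split=> [[y [e /rform_star]]|[e [y rf]]]; first by rewrite invg1; exists e,
  y^-1.
by exists y^-1, e; apply/rform_star; rewrite invg1 invgK.
Qed.

(** The connecting unit [w] is replaced by [w^-1]: this swaps the factors of the product set, and
    inversion preserves the Bruhat order. *)
Lemma le_minus_star r s :
  le_minus Lambda S r s <-> le_plus Lambda S (star r) (star s).
Proof.
split.
  move=> [y [e [x [b [f [a [/rform_star rf /rform_star sf ef [w [wP xw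
    wy]]]]]]]]].
  exists x^-1, e, y^-1, a^-1, f, b^-1; split=> //; exists w^-1; split.
  - have [u eu [v fv <-]] := wP; exists v^-1; first exact: genV.
    by exists u^-1; [apply: genV|rewrite invgM].
  - by rewrite -invgM; apply: bruhatV.
  - by rewrite -invgM; apply: bruhatV.
move=> [x [e [y [a [f [b [rf sf ef [w [wP xw wy]]]]]]]]].
exists y^-1, e, x^-1, b^-1, f, a^-1; split.
- by apply/rform_star; rewrite !invgK.
- by apply/rform_star; rewrite !invgK.
- by [].
exists w^-1; split.
- have [u eu [v fv <-]] := wP; exists v^-1; first exact: genV.
  by exists u^-1; [apply: genV|rewrite invgM].
- by rewrite -invgM; apply: bruhatV.
- by rewrite -invgM; apply: bruhatV.
Qed.

(** * Two-factor descriptions of the three subsets *)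

Lemma O_formP r : O_mon Lambda S r <->
  exists a e c, [/\ r = (a : R) * e * (c : R), Lambda e,
    min_left_coset S (lam S e) a & min_right_coset S (lam S e) c].
Proof.
split=> [[a [e [c [-> Le amin _ cmin]]]]|[a [e [c [-> Le amin cmin]]]]].
  exists a, e, c; split=> //.
  by rewrite unit_val_1 mulg1 -(mulgA _ e e) (idemL Le).
exists a, e, c; split=> //; last exact: gen1.
by rewrite unit_val_1 mulg1 -(mulgA _ e e) (idemL Le).
Qed.

Lemma O_star r : O_mon Lambda S r -> O_mon Lambda S (star r).
Proof.
move=> /O_formP[a [e [c [-> Le amin cmin]]]]; apply/O_formP.
exists c^-1, e, a^-1; split=> //.
- by rewrite (star_form RC) //; apply: idemL.
- by apply/(min_right_cosetV cS); rewrite invgK.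
- exact/(min_right_cosetV cS).
Qed.

Lemma O_lform a e c : Lambda e -> min_left_coset S (lam S e) a ->
  min_right_coset S (lam S e) c -> lform ((a : R) * e * (c : R)) a e c.
Proof.
by move=> Le amin cmin; split=> //; apply: min_left_coset_sub amin;
  apply: lam_sub_lam.
Qed.

Lemma GJ_formP r : GJ_plus Lambda S r <->
  exists e y, [/\ r = e * (y : R), Lambda e & min_right_coset S (lam S e) y].
Proof.
split=> [[e [y [-> Le _ ymin]]]|[e [y [-> Le ymin]]]]; exists e, y; split=> //.
- by rewrite unit_val_1 mul1g.
- by rewrite unit_val_1 mul1g.
- by apply: (min_left_coset1 cS); apply: lam_subS.
Qed.

Lemma JG_formP r : JG_minus Lambda S r <->
  exists y e, [/\ r = (y : R) * e, Lambda e & min_left_coset S (lam S e) y].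
Proof.
rewrite JG_star GJ_formP; split=> [[e [y [rE Le ymin]]]|[y [e [-> Le ymin]]]].
  exists y^-1, e; split=> //; last by apply/(min_right_cosetV cS);
    rewrite invgK.
  by rewrite -(starK RC r) rE (star_mulr RC) //; apply: idemL.
exists e, y^-1; split=> //; last exact/(min_right_cosetV cS).
by rewrite -[y in LHS]invgK -(star_mulr RC) ?(starK RC) //; apply: idemL.
Qed.

Lemma GJ_O r : GJ_plus Lambda S r -> O_mon Lambda S r.
Proof.
move=> /GJ_formP[e [y [-> Le ymin]]]; apply/O_formP; exists 1, e, y.
by split=> //; rewrite ?unit_val_1 ?mul1g//; apply: (min_left_coset1 cS);
  apply: lamS.
Qed.

(** * Closure under products *)

Lemma conjg_commute w x : commute w x -> w ^ x = w.
Proof. by move=> wx; rewrite /conjg wx mulKg. Qed.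

Lemma lam_sup_lam e : Lambda e -> lam_sup S e `<=` lam S e.
Proof. by move=> Le w /lam_supP[Sw we _]; apply/lamP. Qed.

Lemma lam_sup_conj h g w : Lambda h -> fixer h g -> lam_sup S h w -> w ^ g = w.
Proof.
move=> Lh hg hw; apply: conjg_commute.
by apply: (lam_sup_commute Lh) hg; apply: gen_subgroup_sub.
Qed.

Lemma fixer_inversion h g w : Lambda h -> fixer h g -> S w -> ~ fixer h w ->
  inversion S g w = false.
Proof.
move=> Lh hg Sw hw; apply/negP => gw; apply: hw.
rewrite -lam_sub_gen// in hg *; apply: gen_subgroup_sub.
exact: (gen_inversion_gen cS (lam_subS Lh) Sw hg gw).
Qed.

Lemma fixerV h g : fixer h g -> fixer h g^-1.
Proof. exact: subgroupV (fixer_subgroup h). Qed.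

Lemma centralizerV h g : centralizer h g -> centralizer h g^-1.
Proof. exact: subgroupV (centralizer_subgroup h). Qed.

(** The conjugate [w ^ x] is a reflection in the parabolic subgroup for which [a] is minimal. In the
    cocycle rule this makes the contribution of [a] vanish. *)
Lemma min_left_lam_inversion e a w x : Lambda e -> min_left_coset S (lam S e) a
  ->
  lam S e w -> centralizer e x -> inversion S a (w ^ x) = false.
Proof.
move=> Le amin ew ex; apply/negbTE; apply: (no_inversion_in_parabolic cS amin).
  by apply/reflectionJ/reflection_gen; apply: lamS ew.
by apply: genJ; [apply: gen_subgroup_sub|rewrite lam_gen].
Qed.

(** Descents in [lam_sub S h] are removed by some [c] that [h] absorbs. As [c] commutes with
    [lam_sup S h] and has no inversion there, no descent in [lam_sup S h] is created. *)
Lemma mul_min_right_lam h y : Lambda h ->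
  (forall w, lam_sup S h w -> ~~ inversion S y^-1 w) ->
  exists z, h * (y : R) = h * (z : R) /\ min_right_coset S (lam S h) z.
Proof.
move=> Lh hy; have [c hc /(min_left_cosetP cS _ (lam_subS Lh)) cmin] :=
  min_left_coset_ex cS y^-1 (lam_subS Lh).
rewrite lam_sub_gen// in hc; exists (c^-1 * y); split.
  by rewrite unit_valM mulgA (fixerV hc).2.
apply/(min_right_cosetP cS _ (lamS Lh)) => w; rewrite invgM invgK.
move=> /(lam_split Lh)[/cmin //|hw]; have [Sw _ nhw] := (lam_supP h w).1 hw.
rewrite (inversionM cS) (fixer_inversion Lh hc)//=.
by rewrite (lam_sup_conj Lh (fixerV hc))//; apply: hy.
Qed.

Lemma mul_min_left_lam h x : Lambda h ->
  (forall w, lam_sup S h w -> ~~ inversion S x w) ->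
  exists a, (x : R) * h = (a : R) * h /\ min_left_coset S (lam S h) a.
Proof.
move=> Lh hx; have [|z [hz zmin]] := @mul_min_right_lam h x^-1 Lh.
  by move=> w; rewrite invgK; apply: hx.
exists z^-1; split; last by apply/(min_right_cosetV cS); rewrite invgK.
by rewrite -(star_mulr RC) -?hz ?(star_mulr RC) ?invgK //; apply: idemL.
Qed.

Lemma O_intro x h y : Lambda h ->
  (forall w, lam_sup S h w -> ~~ inversion S x w) ->
  (forall w, lam_sup S h w -> ~~ inversion S y^-1 w) ->
  O_mon Lambda S ((x : R) * h * (y : R)).
Proof.
move=> Lh hx hy; have [a [xa amin]] := mul_min_left_lam Lh hx.
have [z [yz zmin]] := mul_min_right_lam Lh hy.
apply/O_formP; exists a, h, z; split=> //.
by rewrite xa -mulgA yz mulgA.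
Qed.

Lemma Lambda_conj_centralizer e f w : Lambda e -> Lambda f ->
  (w : R) * e * (w^-1 : R) = f -> centralizer e w.
Proof.
move=> Le Lf wf; have [|_] := @Lambda_conj_eq _ _ _ RC e f w^-1 1 Le Lf.
  by rewrite invgK wf invg1 unit_val_1 mulg1 mul1g.
by rewrite mul1g invgK.
Qed.

(** The meet [k] of [e] and [w * f * w^-1] is brought to [h] in [Lambda] twice: by [v] in the
    centralizer of [e], and, after conjugation by [w], by [u] in the centralizer of [f]. Then
    [v * w * u^-1] centralizes [h] and splits by [centralizer_split]. *)
Lemma double_coset_decomp e f w : Lambda e -> Lambda f -> exists h v g u,
  [/\ Lambda h, idem_le h e & idem_le h f] /\
  [/\ centralizer e v, fixer h g, centralizer f u, w = v * g * u &
      e * (g : R) * f = h].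
Proof.
move=> Le Lf; have [f' f'E] : exists f', f' = (w : R) * f * (w^-1 : R) by
  eexists.
have idf' : idempotents f' by rewrite f'E; apply: idempotent_conj; apply: idemL.
have [k kE] : exists k, k = e * f' by eexists.
have := rc_meet RC (idemL Le) idf'; rewrite -kE => -[idk ke kf' _].
have [v [h [e1 [Lh Le1 he1 kh ee1]]]] := rc_conj_pair RC idk (idemL Le) ke.
have ve := Lambda_conj_centralizer Le Le1 ee1.
have e1E : e1 = e by rewrite -ee1 ve unit_valK.
have [k' k'E] : exists k', k' = (w^-1 : R) * k * (w : R) by eexists.
have k'f : idem_le k' f.
  have wf : (w : R) * f = f' * (w : R) by rewrite f'E unit_valVK.
  have fw : f * (w^-1 : R) = (w^-1 : R) * f' by rewrite f'E !mulgA !unit_simp.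
  split; first by rewrite k'E -!mulgA wf (mulgA k) kf'.1.
  by rewrite k'E !mulgA fw -(mulgA _ f') kf'.2.
have idk' : idempotents k' by rewrite k'E; apply: idempotent_conjV.
have [u [h2 [f1 [Lh2 Lf1 hf1 kh2 ff1]]]] := rc_conj_pair RC idk' (idemL Lf) k'f.
have uf := Lambda_conj_centralizer Lf Lf1 ff1.
have f1E : f1 = f by rewrite -ff1 uf unit_valK.
have khE : k = (v^-1 : R) * h * (v : R) by rewrite -kh !mulgA !unit_simp.
have [hh2 hc] : h = h2 /\ centralizer h ((u * w^-1) * v^-1).
  apply: (Lambda_conj_eq RC Lh Lh2); rewrite -khE -kh2 k'E.
  by rewrite invgM invgK !unit_valM !mulgA !unit_simp.
have hc' : centralizer h (v * w * u^-1).
  by have := centralizerV hc; rewrite !invgM !invgK !mulgA.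
have [t [g [ht hg vwu]]] := centralizer_split Lh hc'.
rewrite e1E in he1; rewrite f1E -hh2 in hf1.
(* By monotonicity of [lam_sup] (axiom (v)), [t] also centralizes [e], so it can be merged with
   [v^-1]. *)
have et : centralizer e t.
  apply: lam_sup_gen; move: t ht {vwu}; apply: gen_subP;
    first exact: gen_is_subgroup.
  by move=> t /(rc_lam_sup_mono RC Lh Le he1); apply: gen_subgroup_sub.
exists h, (v^-1 * t), g, u; split=> //; split=> //.
- by apply: subgroupM => //; [exact: centralizer_subgroup|exact: centralizerV].
- by rewrite -(mulgA _ t) -vwu !mulgA mulVg mul1g mulgVK.
have [x xE] : exists x, x = t^-1 * v by eexists.
have ex : centralizer e x.
  rewrite xE; apply: subgroupM => //; first exact: centralizer_subgroup.
  exact: centralizerV.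
have gE : g = x * w * u^-1 by rewrite -[LHS](mulKg t) -vwu xE !mulgA.
have hx : h * (t^-1 : R) = (t^-1 : R) * h.
  by apply/esym/centralizerV; apply: lam_sup_gen.
(* Since [w * f = f' * w], the product [e * w * f] is [k * w]. *)
have ewf : e * (w : R) * f = (v^-1 : R) * h * (v : R) * (w : R).
  by rewrite -khE kE f'E !mulgA !unit_simp.
rewrite -[RHS]hg.2 gE !unit_valM !mulgA -ex.
rewrite -(mulgA _ _ f) (centralizerV uf) mulgA -2!(mulgA (x : R)) ewf xE
  !unit_valM.
by rewrite !mulgA !unit_simp hx.
Qed.

(* Among all decompositions y = v g u, one with v as short as possible has
   v = 1: a descent s of v in lam e can be moved into g if s fixes h, and
   otherwise, y having no inversion in lam e, g^-1 s g is an inversion of u^-1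
   and s can be moved into u. *)
Lemma min_right_decomp e f y : Lambda e -> Lambda f ->
  min_right_coset S (lam S e) y -> exists h g u,
  [/\ Lambda h, idem_le h e & idem_le h f] /\
  [/\ fixer h g, centralizer f u, y = g * u & e * (g : R) * f = h].
Proof.
move=> Le Lf; rewrite -{1}[y]invgK (min_right_cosetV cS) => ymin.
have [h [v [g [u [[Lh he hf] [ev hg fu yE egf]]]]]] := double_coset_decomp y Le
  Lf.
exists h; suff [g' [u' H]] : exists g' u',
  [/\ fixer h g', centralizer f u', y = g' * u' & e * (g' : R) * f = h].
  by exists g', u'.
have [n nv] := ubnP (coxeter_length S v).
elim: n => // n IHn in v g u nv ev hg fu yE egf *.
have [v1|v1] := pselect (v = 1); first by exists g, u; split;
  rewrite // yE v1 mul1g.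
have lv : gen_subgroup (lam S e) v by rewrite lam_gen.
have [s es vs] := gen_neq1_inversion cS (lamS Le) lv v1.
have [Ss se] := (lamP s Le).1 es; have ss := coxeter_sqr cS Ss.
have rs := reflection_gen Ss.
have nvs : coxeter_length S (v * s) < n.
  by rewrite -ltnS; apply: leq_trans nv; rewrite ltnS -inversion_length.
have evs : centralizer e (v * s) by apply: subgroupM => //;
  apply: centralizer_subgroup.
have [hs|hs] := pselect (fixer h s).
  apply: (IHn (v * s) (s * g) u) => //.
  - by apply: subgroupM => //; apply: fixer_subgroup.
  - by rewrite yE -!mulgA (mulgA s s) ss mul1g.
  - by rewrite unit_valM !mulgA -se -!mulgA (mulgA e) egf hs.1.
apply: (IHn (v * s) g (s ^ g * u)) => //; last first.
  rewrite yE /conjg !mulgA -(mulgA _ g g^-1) mulgV mulg1.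
  by rewrite -(mulgA v s) ss mulg1.
apply: subgroupM => //; first exact: centralizer_subgroup.
have : inversion S (y^-1 * v) s.
  rewrite (inversionM cS) vs.
  by rewrite (min_left_lam_inversion Le ymin es (centralizerV ev)).
have -> : y^-1 * v = u^-1 * g^-1 by rewrite yE !invgM !mulgA mulgVK.
rewrite (inversionM cS) (fixer_inversion Lh (fixerV hg) Ss hs) invgK /= => us.
rewrite -lam_gen//; apply: (gen_inversion cS (lamS Lf) _ us).
by rewrite lam_gen//; apply: centralizerV.
Qed.

Lemma lam_sup_le h e : Lambda h -> Lambda e -> idem_le h e ->
  lam_sup S h `<=` lam S e.
Proof.
by move=> Lh Le he w /(rc_lam_sup_mono RC Lh Le he); apply: lam_sup_lam.
Qed.

(** A decomposition of [y] without left factor turns the product into [h * (u * z)]. For [w] in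
    [lam_sup S h], the cocycle rule gives no inversion of [z^-1 * u^-1]: the minimality of [z]
    handles [z^-1], and [u^-1] has the same parity at [w] as [y^-1]. *)
Lemma GJ_mul r s : GJ_plus Lambda S r -> GJ_plus Lambda S s ->
  GJ_plus Lambda S (r * s).
Proof.
move=> /GJ_formP[e [y [-> Le ymin]]] /GJ_formP[f [z [-> Lf zmin]]].
have [h [g [u [[Lh he hf] [hg fu yE egf]]]]] := min_right_decomp Le Lf ymin.
have -> : e * (y : R) * (f * (z : R)) = h * ((u * z : W) : R).
  by rewrite -egf yE !unit_valM -!mulgA (mulgA f) -fu !mulgA.
have [w hw|x [-> xmin]] := @mul_min_right_lam h (u * z) Lh; last first.
  by apply/GJ_formP; exists h, x.
have [Sw _ nhw] := (lam_supP h w).1 hw.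
move: ymin zmin; rewrite -{1}[y]invgK -{1}[z]invgK !(min_right_cosetV cS) =>
  ymin zmin.
rewrite invgM (inversionM cS) (min_left_lam_inversion Lf zmin) ?addbF.
- have /(min_left_cosetP cS _ (lamS Le))/(_ w) := ymin.
  rewrite yE invgM (inversionM cS) (fixer_inversion Lh (fixerV hg))//=.
  rewrite invgK (lam_sup_conj Lh hg hw); apply; exact: lam_sup_le he _ hw.
- exact: lam_sup_le hf _ hw.
- by rewrite invgK.
Qed.

Lemma double_coset_min_decomp e f c a : Lambda e -> Lambda f ->
  min_right_coset S (lam S e) c -> min_left_coset S (lam S f) a ->
  exists h v u, [/\ Lambda h, idem_le h e & idem_le h f] /\
  [/\ centralizer e v, centralizer f u,
      e * ((c * a : W) : R) * f = (v : R) * h * (u : R) &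
      forall w, lam_sup S h w -> inversion S v w = false /\ inversion S u^-1 w =
        false].
Proof.
move=> Le Lf; rewrite -{1}[c]invgK (min_right_cosetV cS) => cmin amin.
have [h [v [g [u [[Lh he hf] [ev hg fu caE egf]]]]]] := double_coset_decomp (c *
  a) Le Lf.
(* The descents of [v] in [lam_sup S h] are removed by [t]; it commutes with [g], so [t^-1] can be
   carried across [g] into [u]. *)
have [t ht /(min_left_cosetP cS _ (@lam_supS h)) vtmin] := min_left_coset_ex cS
  v (@lam_supS h).
have cent_t e' : Lambda e' -> idem_le h e' -> centralizer e' t.
  move=> Le' he'; rewrite -lam_gen//; move: t ht {vtmin}; apply: gen_subP.
    exact: gen_is_subgroup.
  by move=> t /(lam_sup_le Lh Le' he'); apply: gen_subgroup_sub.
have tg : t * g = g * t by apply: (lam_sup_commute Lh).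
have evt : centralizer e (v * t).
  by apply: subgroupM => //; [exact: centralizer_subgroup|exact: cent_t].
have fut : centralizer f (t^-1 * u).
  apply: subgroupM => //; first exact: centralizer_subgroup.
  by apply: centralizerV; apply: cent_t.
have {}caE : c * a = (v * t) * g * (t^-1 * u).
  by rewrite caE !mulgA -(mulgA v t) tg !mulgA mulgK.
exists h, (v * t), (t^-1 * u); split=> //.
move: (v * t) (t^-1 * u) evt fut caE vtmin => {ev fu ht cent_t tg}{v u t} v u ev
  fu caE vmin.
split=> // [|w hw].
  by rewrite caE !unit_valM -egf !mulgA -ev -!mulgA fu.
have vw : inversion S v w = false by apply/negbTE/vmin.
split=> //; have [Sw _ nhw] := (lam_supP h w).1 hw.
have ew := lam_sup_le Lh Le he hw; have fw := lam_sup_le Lh Lf hf hw.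
(* This element also equals [a * u^-1 * g^-1]. There [a] and [g^-1] contribute 0 at [w], so the
   parity of [u^-1] vanishes as well. *)
have : inversion S (c^-1 * v) w = false.
  by rewrite (inversionM cS) vw (min_left_lam_inversion Le cmin ew (centralizerV
    ev)).
have -> : c^-1 * v = a * u^-1 * g^-1.
  by apply: (mulgI c); rewrite !mulgA mulgV mul1g caE !mulgK.
rewrite (inversionM cS) (fixer_inversion Lh (fixerV hg))//= invgK.
rewrite (lam_sup_conj Lh hg hw) (inversionM cS) invgK.
by rewrite (min_left_lam_inversion Lf amin fw fu) addbF.
Qed.

Lemma O_mul r s : O_mon Lambda S r -> O_mon Lambda S s -> O_mon Lambda S (r *
  s).
Proof.
move=> /O_formP[b [e [c [-> Le bmin cmin]]]] /O_formP[a [f [d [-> Lf amin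
  dmin]]]].
have [h [v [u [[Lh he hf] [ev fu E inv]]]]] := double_coset_min_decomp Le Lf
  cmin amin.
have -> : (b : R) * e * (c : R) * ((a : R) * f * (d : R)) =
          ((b * v : W) : R) * h * ((u * d : W) : R).
  have := congr1 (fun t : R => (b : R) * t * (d : R)) E.
  by rewrite !unit_valM !mulgA.
apply: O_intro => // w hw; have [vw uw] := inv w hw.
  by rewrite (inversionM cS) vw (min_left_lam_inversion Le bmin (lam_sup_le Lh
    Le he hw) (centralizerV ev)).
move: dmin; rewrite -{1}[d]invgK (min_right_cosetV cS) => dmin.
rewrite invgM (inversionM cS) uw invgK.
by rewrite (min_left_lam_inversion Lf dmin (lam_sup_le Lh Lf hf hw) fu).
Qed.

(** * Submonoids and generation *)

Lemma Lambda1 : Lambda 1.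
Proof.
have [f [[Lf [w fE]] _]] := rc_transversal RC (mul1g 1 : idempotents 1).
by rewrite -fE mulg1 unit_valV in Lf.
Qed.

Lemma GJ1 : GJ_plus Lambda S 1.
Proof.
apply/GJ_formP; exists 1, 1; split; [by rewrite unit_val_1 mul1g|exact:
  Lambda1|].
apply/(min_right_cosetP cS _ (lamS Lambda1)) => w _.
by rewrite invg1 (inversion1 cS).
Qed.

Lemma star1 : star 1 = 1 :> R.
Proof. by apply: (star_eq RC); split; rewrite !mulg1. Qed.

Lemma GJ_submonoid : is_submonoid (GJ_plus Lambda S).
Proof. by split; [exact: GJ1|exact: GJ_mul]. Qed.

Lemma JG_submonoid : is_submonoid (JG_minus Lambda S).
Proof.
split=> [|r s /JG_star rG /JG_star sG]; apply/JG_star.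
  by rewrite star1; apply: GJ1.
by rewrite (starM RC); apply: GJ_mul.
Qed.

Lemma O_submonoid : is_submonoid (O_mon Lambda S).
Proof. by split; [exact/GJ_O/GJ1|exact: O_mul]. Qed.

Lemma O_inverse_submonoid : is_inverse_submonoid (O_mon Lambda S).
Proof.
split=> [|r Or]; first exact: O_submonoid.
exists (star r); split=> [|t [_ /(star_eq RC)//]].
by split; [apply: O_star|apply: (starP RC)].
Qed.

(** An inverse taken inside [M] is a weak inverse in [R], hence equals [star r] by uniqueness. *)
Lemma inverse_submonoid_star (M : set R) r : is_inverse_submonoid M -> M r ->
  M (star r).
Proof.
by move=> [_ MV] /MV[t [[Mt /(star_eq RC) ->] _]].
Qed.

Lemma JG_O r : JG_minus Lambda S r -> O_mon Lambda S r.
Proof. by move=> /JG_star/GJ_O/O_star; rewrite (starK RC). Qed.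

(** The factorization [a * e * c = (a * e) * (e * c)] has its first factor in [JG_minus] and its
    second in [GJ_plus]. *)
Lemma O_sub (M : set R) : is_submonoid M -> GJ_plus Lambda S `<=` M ->
  JG_minus Lambda S `<=` M -> O_mon Lambda S `<=` M.
Proof.
move=> [_ MM] GM JM r /O_formP[a [e [c [-> Le amin cmin]]]].
have -> : (a : R) * e * (c : R) = (a : R) * e * (e * (c : R)).
  by rewrite !mulgA -(mulgA _ e e) (idemL Le).
apply: MM; [apply: JM; apply/JG_formP; exists a, e|apply: GM; apply/GJ_formP;
  exists e, c];
  by split.
Qed.

(** * Representatives of Green classes *)

Lemma GJ_greenL_uniq r s : GJ_plus Lambda S r -> GJ_plus Lambda S s ->
  greenL r s -> r = s.
Proof.
move=> [e [y rf]] [f [z sf]] rs; have [ef yz] := lform_greenL rf sf rs.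
by have [-> _ _ _] := rf; have [-> _ _ _] := sf; rewrite ef yz.
Qed.

Lemma GJ_greenL_ex r : exists2 s, GJ_plus Lambda S s & greenL s r.
Proof.
have [x [e [y [-> Le _ ymin]]]] := lform_ex r.
exists (((1 : W) : R) * e * (y : R)).
  by apply/GJ_formP; exists e, y; rewrite unit_val_1 mul1g.
by apply/(greenL_form RC) => //; apply: idemL.
Qed.

Lemma O_greenR_eq a e x y y' : Lambda e -> min_left_coset S (lam S e) a ->
  greenR ((a : R) * e * (y : R)) ((x : R) * e * (y' : R)) ->
  exists2 v, centralizer e v & x = a * v.
Proof.
move=> Le amin /(greenR_form RC)-/(_ (idemL Le) (idemL Le)) ax.
exists (a^-1 * x); last by rewrite mulVKg.
have [|_] := @Lambda_conj_eq _ _ _ RC e e x^-1 a^-1 Le Le;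
  last by rewrite invgK.
by rewrite !invgK.
Qed.

Lemma O_greenH_uniq r s : O_mon Lambda S r -> O_mon Lambda S s ->
  greenH r s -> r = s.
Proof.
move=> /O_formP[a [e [c [-> Le amin cmin]]]] /O_formP[a' [f [c' [-> Lf amin'
  cmin']]]].
move=> [rsL rsR]; have [ef cc] := lform_greenL (O_lform Le amin cmin)
  (O_lform Lf amin' cmin') rsL.
rewrite -ef -cc in amin' rsR *; have [v ev aE] := O_greenR_eq Le amin rsR.
rewrite aE in amin' *; rewrite (min_left_coset_eq amin amin')//.
by rewrite lam_gen.
Qed.

(** The left factor is replaced by the minimal element of its coset modulo the centralizer of [e]:
    the L-class ignores the left factor, and the R-class sees only that coset. *)
Lemma O_greenH_ex r : exists2 s, O_mon Lambda S s & greenH s r.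
Proof.
have [x [e [y [-> Le _ ymin]]]] := lform_ex r.
have [c ec amin] := min_left_coset_ex cS x (lamS Le); rewrite lam_gen// in ec.
exists (((x * c : W) : R) * e * (y : R)); first by apply/O_formP;
  exists (x * c), e, y.
split; first by apply/(greenL_form RC) => //; apply: idemL.
apply/(greenR_form RC); [exact: idemL|exact: idemL|].
by rewrite invgM !unit_valM !mulgA -(mulgA _ (c : R) e) ec !mulgA !unit_simp.
Qed.

(** * Minimal elements of Green classes and comparison of representatives *)

Lemma GJ_le r s : GJ_plus Lambda S r -> greenL r s -> le_plus Lambda S r s.
Proof.
move=> [e [y rf]] rs; have [x sf] := greenL_lform rf rs.
apply: (lform_le1 rf sf); [|exact: bruhat1|exact: bruhat_refl].
by apply: idem_lexx; have [_ Le _ _] := rf; apply: idemL.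
Qed.

(** Comparing [r] with the representative of its L-class in [GJ_plus] puts the left factor of [r]
    below 1. *)
Lemma le_GJ r : (forall s, greenL r s -> le_plus Lambda S r s) ->
  GJ_plus Lambda S r.
Proof.
have [s [e [y sf]] sr] := GJ_greenL_ex r; have [x rf] := greenL_lform sf sr.
move=> /(_ s (esym sr))/(lform_le_same rf sf)/(bruhat_1 cS) x1.
by exists e, y; rewrite -x1.
Qed.

Lemma O_le r s : O_mon Lambda S r -> greenH r s -> le_plus Lambda S r s.
Proof.
move=> /O_formP[a [e [c [-> Le amin cmin]]]] [rsL rsR].
have rf := O_lform Le amin cmin; have [x sf] := greenL_lform rf rsL.
apply: (lform_le1 rf sf); [exact/idem_lexx/idemL| |exact: bruhat_refl].
have [sE _ _ _] := sf; rewrite sE in rsR.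
by have [v ev ->] := O_greenR_eq Le amin rsR; apply: amin; rewrite lam_gen.
Qed.

(** Comparison with the representative in [O_mon] gives [x] below [a]; both lie in one coset, of
    which [a] is the minimum, so they coincide. *)
Lemma le_O r : (forall s, greenH r s -> le_plus Lambda S r s) -> O_mon Lambda S
  r.
Proof.
have [s Os sr] := O_greenH_ex r; have /O_formP[a [e [c [sE Le amin cmin]]]] :=
  Os.
have sf := O_lform Le amin cmin; rewrite -sE in sf.
have [x rf] := greenL_lform sf sr.1 => /(_ s (conj (esym sr.1) (esym sr.2))).
move=> /(lform_le_same rf sf) xa.
have [rE _ _ _] := rf; have := sr.2; rewrite sE rE => /(O_greenR_eq Le amin)[v
  ev xE].
have ax : bruhat S a x by rewrite xE; apply: amin; rewrite lam_gen.
by apply/O_formP; exists a, e, c; split=> //; rewrite (bruhat_anti ax xa).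
Qed.

(** The unit conjugating an element [f] of [Lambda] to the idempotent may be altered by the
    centralizer of [f], hence chosen minimal in its coset. *)
Lemma idem_O e : idempotents e -> O_mon Lambda S e.
Proof.
move=> /(Lambda_conj RC)[f [w [Lf ->]]].
have [c fc amin] := min_left_coset_ex cS w^-1 (lamS Lf);
  rewrite lam_gen// in fc.
apply/O_formP; exists (w^-1 * c), f, (w^-1 * c)^-1; split=> //.
  by rewrite invgM invgK !unit_valM !mulgA -(mulgA _ (c : R) f) fc !mulgA
    !unit_simp.
exact/(min_right_cosetV cS).
Qed.

(** Passing to the representatives keeps the right factors and replaces the left ones by 1. The same
    [w] serves, as 1 is below every element. *)
Lemma le_plus_GJ r s p q : le_plus Lambda S r s ->
  GJ_plus Lambda S p -> greenL r p -> GJ_plus Lambda S q -> greenL s q ->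
  le_plus Lambda S p q.
Proof.
move=> [x [e [y [a [f [b [rf sf ef [w [wP xw wy]]]]]]]]].
move=> [e' [y' pf]] rp [f' [b' qf]] sq.
have [ee yy] := lform_greenL rf pf rp; have [ff bb] := lform_greenL sf qf sq.
rewrite -ee -yy in pf; rewrite -ff -bb in qf.
exists 1, e, y, 1, f, b; split=> //; exists w; split=> //.
exact: bruhat1.
Qed.

End RennerCoxeter.

(** The relation is kept abstract so that one argument covers all three of Green's relations. *)
Lemma set_bij_class (T : Type) (rel : T -> T -> Prop) (A : set T) :
  (forall r, rel r r) -> (forall r s, rel r s -> rel s r) ->
  (forall r s t, rel r s -> rel s t -> rel r t) ->
  (forall r s, A r -> A s -> rel r s -> r = s) ->
  (forall r, exists2 s, A s & rel s r) ->
  set_bij A (range (fun r => [set s | rel r s])) (fun r => [set s | rel r s]).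
Proof.
move=> refl sym trans uniq ex; split=> [r Ar|r s /set_mem Ar /set_mem As rs|_ [r
  _ <-]].
- by exists r.
- by apply: uniq => //; have := refl s; rewrite -[rel s s]/([set t | rel s t] s)
    -rs.
have [s As sr] := ex r; exists s => //; apply/seteqP; split=> t /=.
  exact: trans (sym _ _ sr).
exact: trans sr.
Qed.

Theorem theorem3p8 (R : monoidType) (Lambda : set R) (S : set (unit_group R))
    (RC : renner_coxeter Lambda S) :
  let GJ := GJ_plus Lambda S in
  let JG := JG_minus Lambda S in
  let O := O_mon Lambda S in
  let lep := le_plus Lambda S in
  let lem := le_minus Lambda S in
  (* (1) *)
  (GJ = [set r | forall s, classL r s -> lep r s] /\
   JG = [set r | forall s, classR r s -> lem r s] /\
   O = [set r | forall s, classH r s -> lep r s] /\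
   O = [set r | forall s, classH r s -> lem r s]) /\
  (* (2) *)
  ([set star r | r in GJ] = JG /\ O = [set star r | r in O]) /\
  (* (3) *)
  (is_submonoid GJ /\ is_submonoid JG /\ is_submonoid O) /\
  (* (4) *)
  (is_smallest (@is_submonoid R) (GJ `|` JG) O /\
   is_smallest (@is_inverse_submonoid R) GJ O /\
   is_smallest (@is_inverse_submonoid R) JG O) /\
  (* (5) *)
  @idempotents R `<=` O /\
  (* (6) *)
  (forall r s a b, lep r s -> (GJ `&` classL r) a -> (GJ `&` classL s) b ->
     lep a b) /\
  (* (7) *)
  (forall r s a b, lem r s -> (JG `&` classR r) a -> (JG `&` classR s) b ->
     lem a b) /\
  (* (8) *)
  (set_bij GJ (range (@classL R)) (@classL R) /\
   set_bij JG (range (@classR R)) (@classR R)) /\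
  (* (9) *)
  set_bij O (range (@classH R)) (@classH R).

Proof.
move=> GJ JG O lep lem.
have JGE r : JG r <-> GJ (star r) := JG_star RC r.
have starK := starK RC.
have JG_ex r : exists2 s, JG s & greenR s r.
  have [s Gs sr] := GJ_greenL_ex RC (star r).
  by exists (star s); [apply/JGE; rewrite starK|apply/(greenR_star RC);
    rewrite starK].
have OE r : O (star r) <-> O r.
  by split=> [/(O_star RC)|/(O_star RC)//]; rewrite starK.
have greenH_star (r s : R) : greenH r s -> greenH (star r) (star s).
  move=> [rsL rsR]; split; first exact/(greenR_star RC).
  by apply/(greenR_star RC); rewrite !starK.
have OV : O = [set star r | r in O].
  apply/seteqP; split=> [r Or|_ [r Or <-]]; last exact/OE.
  by exists (star r); [apply/OE|apply: starK].
have GJV : [set star r | r in GJ] = JG.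
  apply/seteqP; split=> [_ [r Gr <-]|r /JGE Gr]; first by apply/JGE;
    rewrite starK.
  by exists (star r); rewrite ?starK.
have invO : is_inverse_submonoid O := O_inverse_submonoid RC.
have GO : GJ `<=` O by move=> r; apply: GJ_O.
have JO : JG `<=` O by move=> r; apply: JG_O.
split; [split; [|split; [|split]]|].
- by apply/seteqP; split=> [r Gr s|r rP]; [apply: GJ_le|apply: (le_GJ RC)].
- apply/seteqP; split=> [r /JGE Gr s /(greenR_star RC) rs|r rP].
    by apply/(le_minus_star RC); apply: GJ_le.
  apply/JGE/(le_GJ RC) => s rs; rewrite -[s]starK; apply/(le_minus_star RC)/rP.
  by apply/(greenR_star RC); rewrite starK.
- by apply/seteqP; split=> [r Or s|r rP]; [apply: O_le|apply: (le_O RC)].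
(* Since [star] preserves both [O] and [greenH], the characterization by [lem] is the one by [lep]
   transported along [star]. *)
- apply/seteqP; split=> [r Or s rs|r rP].
    by apply/(le_minus_star RC); apply: O_le; [|apply/OE|apply: greenH_star].
  apply/OE/(le_O RC) => s rs; rewrite -[s]starK; apply/(le_minus_star RC)/rP.
  by rewrite -[r]starK; apply: greenH_star.
split; first by [].
split; first by split; [exact: GJ_submonoid|split; [exact: JG_submonoid|exact:
  invO.1]].
split.
  split; [|split]; split=> //.
  - exact: invO.1.
  - by move=> r [/GO|/JO].
  - by move=> N mN GJN; apply: (O_sub RC) => // r Gr; apply: GJN; [left|right].
  (* An inverse submonoid containing [GJ] is stable under [star], hence contains [JG] too, and
     [O_sub] applies. *)
  - move=> N iN GN; apply: (O_sub RC iN.1) => // r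
      /JGE/GN/(inverse_submonoid_star RC iN).
    by rewrite starK.
  - move=> N iN JN; apply: (O_sub RC iN.1) => // r Gr; rewrite -[r]starK.
    by apply: (inverse_submonoid_star RC iN); apply: JN; apply/JGE;
      rewrite starK.
split; first by move=> e; apply: idem_O.
split; first by move=> r s a b rs [Ga ra] [Gb sb]; apply: (le_plus_GJ RC rs).
split.
  move=> r s a b /(le_minus_star RC) rs [/JGE Ja /(greenR_star RC) ra].
  move=> [/JGE Jb /(greenR_star RC) sb].
  by apply/(le_minus_star RC); apply: (le_plus_GJ RC rs).
split; [split|].
- apply: set_bij_class => //; [|exact: GJ_greenL_uniq|exact: GJ_greenL_ex].
  by move=> r s t; apply: etrans.
- apply: set_bij_class => //; first by move=> r s t; apply: etrans.
  move=> r s /JGE Gr /JGE Gs rs; rewrite -[r]starK -[s]starK; congr star.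
  by apply: (GJ_greenL_uniq RC Gr Gs); apply/(greenR_star RC).
- apply: set_bij_class; [by []| | |exact: O_greenH_uniq|exact: O_greenH_ex].
    by move=> r s [rsL rsR]; split; apply: esym.
  by move=> r s t [rsL rsR] [stL stR]; split; [apply: etrans stL|apply: etrans
    stR].
Qed.
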